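(* Let $\mathbb{X}$ be a countably infinite alphabet and $\mu$ a probability measure on $\mathbb{X}$ with $\mu(x)>0$ for all $x\in\mathbb{X}$. Let $P\in\mathbb{E}$ with $H(P_1\|\mu)<\infty$. Then $$\lim_{n\to\infty}\frac1n\Big[-\log\mathrm{NPD}_\mu(X_{1:n})-\sum_{i=1}^n\log\mu(X_i)\Big]=h\quad P\text{-a.s.}$$
   Context: On $\mathbb{X}^{\mathbb{Z}}$ (all subsets of $\mathbb{X}$ measurable), $X_k$ are coordinate maps, $x_{j:k}=(x_j,\dots,x_k)$; $P(x_{1:n})$ is the probability of $X_{1:n}=x_{1:n}$ and $P(x)=P(X_1=x)$. $\mathbb{E}$: shift-stationary ergodic probability measures. $h=\lim_n\mathbb{E}[-\log P(X_{1:n})]/n$ (entropy rate w.r.t. counting measure); $H(P_1\|\mu)=-\sum_xP(x)\log\mu(x)$. NPD density: fix finite $\sigma$-fields $\mathcal{X}_0\subset\mathcal{X}_1\subset\cdots$ on $\mathbb{X}$ with $\mathcal{X}_0=\{\emptyset,\mathbb{X}\}$ and $\sigma(\bigcup_l\mathcal{X}_l)=2^{\mathbb{X}}$; let $\chi_l$ be the finite partition generating $\mathcal{X}_l$. For $x\in\mathbb{X}$ let $x^l$ be the cell $A\in\chi_l$ with $x\in A$, $x^l_{1:n}=(x^l_1,\dots,x^l_n)$. Treat $\chi_l$ as a finite alphabet and let $R^l$ be a probability measure on $\chi_l^{\mathbb{Z}}$ universal with respect to the alphabet $\chi_l$ (for every stationary ergodic process $(Y_i)$ over $\chi_l$ with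 Shannon entropy rate $H$, $-\frac1n\log R^l(Y_{1:n})\to H$ a.s., in expectation and in probability). $\mathrm{NPD}^l_\mu(x_{1:n})=R^l(x^l_{1:n})/\prod_{i=1}^n\mu(x_i^l)$, $\mathrm{NPD}_\mu(x_{1:n})=\sum_{l\ge0}w_l\mathrm{NPD}^l_\mu(x_{1:n})$, $w_l=\frac1{l+1}-\frac1{l+2}$. *)

(* Defs.v *)
From HB Require Import structures.
From mathcomp Require Import all_boot all_order all_algebra.
From mathcomp Require Import all_classical all_reals all_analysis.
Set Implicit Arguments. Unset Strict Implicit. Unset Printing Implicit Defensive.
Import Order.TTheory GRing.Theory Num.Theory.
Local Open Scope classical_set_scope.
Local Open Scope ring_scope.

(* Ordinals 'I_n.+1 as pointed types (point = 0), so that they can be used as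
   (finite) alphabets of path spaces below. *)
HB.instance Definition _ (n : nat) := isPointed.Build 'I_n.+1 ord0.

Definition cylinders (A : Type) : set (set (int -> A)) :=
  [set E | exists (i : int) (a : A), E = [set w | w i = a]].

Definition pathsp (A : pointedType) := g_sigma_algebraType (@cylinders A).

Definition shift (A : Type) (w : int -> A) : int -> A := fun i => w (i + 1).

Section process.
Context {R : realType} {A : pointedType}.
Local Notation PS := (pathsp A).

Definition stationary (P : probability PS R) : Prop :=
  forall E : set PS, measurable E -> P (@shift A @^-1` E) = P E.

Definition ergodic (P : probability PS R) : Prop :=
  forall E : set PS, measurable E -> @shift A @^-1` E = E ->
    P E = 0%E \/ P E = 1%E.

Definition cylt (n : nat) (x : n.-tuple A) : set PS :=
  [set w | forall i : 'I_n, w (Posz i.+1) = tnth x i].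

Definition blk (n : nat) (w : PS) : n.-tuple A := [tuple w (Posz i.+1) | i < n].

Definition blockprob (P : probability PS R) (n : nat) (x : n.-tuple A) : R :=
  fine (P (cylt x)).

(* E[-log P(X_{1:n})] = sum_x - P(x) log P(x)  (nonnegative terms) *)
Definition block_entropy (P : probability PS R) (n : nat) : \bar R :=
  (\esum_(x in [set: n.-tuple A]) (- (blockprob P x * ln (blockprob P x)))%:E)%E.

Definition entropy_rate (P : probability PS R) : \bar R :=
  limn (fun n : nat => ((n%:R)^-1)%:E * block_entropy P n)%E.

End process.

Definition elog {R : realType} (x : \bar R) : \bar R :=
  match x with
  | EFin r => if r <= 0 then -oo%E else (ln r)%:E
  | +oo%E => +oo%E
  | -oo%E => -oo%E
  end.

Definition universal {R : realType} {A : pointedType}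
    (Rm : probability (pathsp A) R) : Prop :=
  forall Q : probability (pathsp A) R, stationary Q -> ergodic Q ->
  let H := entropy_rate Q in
  let f := fun (n : nat) (w : pathsp A) =>
             (((n%:R)^-1)%:E * - elog (Rm (cylt (blk n w))))%E in
  {ae Q, forall w, f ^~ w @ \oo --> H}
  /\ (fun n : nat => (\int[Q]_w f n w)%E) @ \oo --> H
  /\ (forall e : R, 0 < e ->
        (fun n : nat => Q [set w | (e%:E <= `| f n w - H |)%E]) @ \oo --> 0%E).

Section NPD.
Context {R : realType} {X : pointedType}.
Variables (mu : X -> R) (k : nat -> nat) (c : forall l, X -> 'I_(k l).+1)
  (Rm : forall l, probability (pathsp 'I_(k l).+1) R).

Definition cross_entropy1 (P : probability (pathsp X) R) : \bar R :=
  (\esum_(x in [set: X])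
     (- (fine (P [set w | w (Posz 1) = x]) * ln (mu x)))%:E)%E.

(* mu(x^l): mu-measure of the cell of chi_l containing x *)
Definition mucell (l : nat) (x : X) : R :=
  fine (\esum_(y in [set y | c l y = c l x]) (mu y)%:E)%E.

Definition NPDl (l n : nat) (x : n.-tuple X) : R :=
  fine (Rm l (cylt (map_tuple (c l) x))) / \prod_(i < n) mucell l (tnth x i).

Definition wgt (l : nat) : R := (l.+1%:R)^-1 - (l.+2%:R)^-1.

Definition NPD (n : nat) (x : n.-tuple X) : \bar R :=
  (\esum_(l in [set: nat]) (wgt l * NPDl l x)%:E)%E.

End NPD.

(* Main.v *)
Require Import Defs.
From HB Require Import structures.
From mathcomp Require Import all_boot all_order all_algebra.
From mathcomp Require Import all_classical all_reals all_analysis measurable_realfun.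
From mathcomp Require Import ring lra zify.
Import Order.TTheory GRing.Theory Num.Theory.
Import numFieldNormedType.Exports.
Local Open Scope classical_set_scope.
Local Open Scope ring_scope.
Set Implicit Arguments. Unset Strict Implicit. Unset Printing Implicit Defensive.

(* The function q(s) = NPD(s) * mu(s_1) ... mu(s_n) has total mass at most 1 on the words of each
   length n, and the quantity in the theorem is - log q(X_{1:n}) / n.

   Lower bound. By Barron's lemma, q(X_{1:n}) <= n (n + 1) P(X_{1:n}) eventually, so it is enough
   that liminf - log P(X_{1:n}) / n >= h. The liminf does not increase under the shift, hence is
   constant by ergodicity. If it were below c < h, almost every position would start a block of
   bounded length coded at rate at most c, and a greedy parsing (Ornstein-Weiss) would give a
   subprobability on words with mean code length below n h, against Gibbs' inequality.

   Upper bound. q is at least w_l times its level-l term. By universality the code length of that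
   term has rate h_l + E log (mu(X^l_1) / mu(X_1)), where h_l <= h is the entropy rate of the
   quantized process. Here only the upper half of Birkhoff's theorem is used, which follows from
   the same greedy parsing. The second summand tends to 0 with l by dominated convergence. *)

(** * Discrete random variables and Gibbs' inequality *)

Lemma esumZl (R : realType) (T : choiceType) (D : set T) (c : R) (a : T -> \bar R) :
  0 <= c -> (forall i, (0 <= a i)%E) ->
  (\esum_(i in D) (c%:E * a i) = c%:E * \esum_(i in D) a i)%E.
Proof.
move=> c0 a0; rewrite /esum -ereal_supZl//; last first.
  by apply/set0P; exists 0%E; exists set0; [exact: fsets_set0|rewrite fsbig_set0].
congr ereal_sup; apply/seteqP; split => [_ [A AD <-]|_ [_ [A AD <-] <-]].
  exists (\sum_(x \in A) a x)%E; first by exists A.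
  by rewrite ge0_mule_fsumr.
by exists A => //; rewrite ge0_mule_fsumr.
Qed.

Lemma countable_seq (T : eqType) : countable [set: T] -> countable [set: seq T].
Proof.
move=> /countable_injP[f finj]; apply/countable_injP.
exists (fun s => pickle (map f s)) => s t _ _ /(pcan_inj pickleK).
by apply: inj_map => x y; apply: finj; rewrite inE.
Qed.

Section integral_discrete.
Local Open Scope ereal_scope.
Context d (T : measurableType d) (R : realType) (mu : {measure set T -> \bar R}).
Context (I : choiceType) (Y : T -> I).
Hypothesis cI : countable [set: I].
Hypothesis mY : forall i, measurable (Y @^-1` [set i]).

Lemma measurable_preimage_discrete (B : set I) : measurable (Y @^-1` B).
Proof.
have -> : Y @^-1` B = \bigcup_i (if i \in B then Y @^-1` [set i] else set0).
  apply/seteqP; split => [w Bw|w [i _]]; first by exists (Y w); rewrite ?mem_set.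
  by case: ifPn => // /set_mem Bi /= ->.
by apply: countable_bigcupT_measurable => // i; case: ifPn.
Qed.

Lemma measurable_fun_discrete d' (T' : sigmaRingType d') (g : I -> T') :
  measurable_fun setT (fun w => g (Y w)).
Proof.
by move=> _ B mB; rewrite setTI; exact: (measurable_preimage_discrete (g @^-1` B)).
Qed.

Lemma integral_discrete (g : I -> \bar R) : (forall i, 0 <= g i) ->
  \int[mu]_w g (Y w) = \esum_(i in [set: I]) (g i * mu (Y @^-1` [set i])).
Proof.
(* The injection [f] numbers the values of [Y]; each [J n] is empty or a singleton, so the integrand
   is constant on each [F n]. *)
move=> g0; have /countable_injP[f finj] := cI.
pose J n := f @^-1` [set n]; pose F n := Y @^-1` (J n).
have cupF : \bigcup_n F n = setT.
  by apply/seteqP; split => // w _; exists (f (Y w)).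
have mF n : measurable (F n) by exact: measurable_preimage_discrete.
rewrite -cupF ge0_integral_bigcup//; last 2 first.
  - by rewrite cupF; exact: measurable_fun_discrete.
  - by move=> i j _ _ [w [/= <- <-]].
rewrite nneseries_esumT; last by move=> n; exact: integral_ge0.
rewrite (_ : [set: I] = \bigcup_(n in setT) J n); last first.
  by apply/seteqP; split => // i _; exists (f i).
rewrite esum_bigcupT//; last 2 first.
  - by move=> i j _ _ [w [/= <- <-]].
  - by move=> i; rewrite mule_ge0.
apply: eq_esum => n _.
have [[i Ji]|nJ] := pselect (exists i, J n i); last first.
  have J0 : J n = set0 by apply/seteqP; split => // i Ji; case: nJ; exists i.
  by rewrite J0 esum_set0 /F J0 preimage_set0 integral_set0.
have JE : J n = [set i].
  apply/seteqP; split => [j Jj|j -> //]; apply: finj; rewrite ?inE//.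
  by move: Ji Jj; rewrite /J/= => -> ->.
rewrite JE esum_set1 ?mule_ge0// -integral_cst -?JE; last exact: mF.
by apply: eq_integral => w; rewrite inE /F JE => /= ->.

Qed.

End integral_discrete.

Lemma ln_le_subr1 (R : realType) (x : R) : 0 < x -> ln x <= x - 1.
Proof.
by move=> x0; rewrite -[in X in X <= _](subrKC 1 x) le_ln1Dx// ltrBrDl addrN.
Qed.

(* Both sides are shifted by the masses, so that all the sums have nonnegative terms. *)
Lemma gibbs (R : realType) (I : choiceType) (D : set I) (p q : I -> R) :
  (forall i, 0 <= p i <= 1) -> (forall i, 0 <= q i <= 1) ->
  (forall i, 0 < p i -> 0 < q i) ->
  \esum_(i in D) (p i)%:E = 1%E -> (\esum_(i in D) (q i)%:E <= 1)%E ->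
  (\esum_(i in D) (- (p i * ln (p i)))%:E <= \esum_(i in D) (- (p i * ln (q i)))%:E)%E.
Proof.
move=> p01 q01 pq p1 q1.
have pq0 (r s : R) : 0 <= r <= 1 -> 0 <= s <= 1 -> 0 <= - (r * ln s).
  by move=> /andP[r0 _] /andP[_ s1]; rewrite -mulrN mulr_ge0// oppr_ge0 ln_le0.
suff : (\esum_(i in D) (- (p i * ln (p i)))%:E + 1 <=
        \esum_(i in D) (- (p i * ln (q i)))%:E + 1)%E by rewrite leeD2rE.
rewrite -{1}p1; apply: (@le_trans _ _ (\esum_(i in D) (- (p i * ln (q i)))%:E +
   \esum_(i in D) (q i)%:E)%E); last by rewrite leeD2l.
rewrite -!esumD; try by move=> i _; rewrite lee_fin ?pq0//;
  case/andP: (p01 i) (q01 i) => ? ? /andP[].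
apply: le_esum => i _; rewrite -!EFinD lee_fin.
have /andP[] := p01 i; rewrite le_eqVlt => /predU1P[<- _|p0 _].
  by rewrite !mul0r oppr0 !add0r; case/andP: (q01 i).
have q0 := pq _ p0.
(* This is [p] times the inequality [ln (q / p) <= q / p - 1]. *)
have := ln_le_subr1 (divr_gt0 q0 p0); rewrite ln_div// => /(ler_wpM2l (ltW p0)).
by rewrite !mulrBr mulrCA divff ?gt_eqF// !mulr1; lra.
Qed.

(** * Words of a path *)

Section word.
Context {A : pointedType}.
Implicit Types (w : pathsp A) (s : seq A).

Definition pshift (w : pathsp A) : pathsp A := Defs.shift w.

(** A list instead of a tuple, so that words of all lengths share one type and can be cut and
    concatenated without casts. Coordinates start at 1, as in [blk]. *)
Definition word (n : nat) (w : pathsp A) : seq A :=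
  [seq w (Posz i.+1) | i <- iota 0 n].

Lemma size_word n w : size (word n w) = n.
Proof. by rewrite size_map size_iota. Qed.

Lemma wordS n w : word n.+1 w = w (Posz 1) :: word n (pshift w).
Proof.
rewrite /word /= -[in LHS](addn0 1%N) iotaDl -map_comp; congr cons.
by apply: eq_map => i /=; rewrite /pshift /Defs.shift; congr w; lia.
Qed.

Lemma word1 w : word 1 w = [:: w (Posz 1)].
Proof. by rewrite wordS. Qed.

Lemma wordD n m w : word (n + m) w = word n w ++ word m (iter n pshift w).
Proof. by elim: n w => // n IH w; rewrite addSn !wordS IH -iterSr. Qed.

Lemma iter_pshift n w (i : int) : iter n pshift w i = w (i + Posz n).
Proof.
elim: n i => [|n IH] i /=; first by rewrite addr0.
by rewrite /pshift /Defs.shift IH; congr w; lia.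
Qed.

Lemma tval_blk n w : tval (blk n w) = word n w.
Proof.
by rewrite /blk /= /word -val_enum_ord -map_comp.
Qed.

Lemma cyltE n (x : n.-tuple A) : cylt x = word n @^-1` [set tval x].
Proof.
apply/seteqP; split => w /=; rewrite /cylt /=.
  by move=> wx; rewrite -tval_blk; congr tval; apply: eq_from_tnth => i; rewrite tnth_mktuple.
move=> wx i; rewrite (tnth_nth point) -wx (nth_map 0%N) ?size_iota//.
by rewrite nth_iota.
Qed.

Lemma measurable_coord (i : int) (a : A) : measurable [set w : pathsp A | w i = a].
Proof. by apply: sub_sigma_algebra; exists i, a. Qed.

Lemma measurable_pshift : measurable_fun setT pshift.
Proof.
apply: (@measurability _ _ (pathsp A) (pathsp A) _ _ (@cylinders A)) => //.
move=> _ [_ [i [a ->]] <-]; rewrite setTI; exact: (measurable_coord (i + 1) a).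
Qed.

Lemma measurable_iter_pshift n : measurable_fun setT (iter n pshift).
Proof.
elim: n => [|n IH]; first exact: measurable_id.
exact: (measurableT_comp measurable_pshift IH).
Qed.

Lemma measurable_word n s : measurable (word n @^-1` [set s]).
Proof.
elim: n s => [|n IH] s.
  case: s => [|x s]; last by rewrite (_ : _ @^-1` _ = set0)//; apply/seteqP; split.
  by rewrite (_ : _ @^-1` _ = setT)//; apply/seteqP; split.
case: s => [|x s].
  by rewrite (_ : _ @^-1` _ = set0)//; apply/seteqP; split => // w; rewrite /= wordS.
rewrite (_ : _ @^-1` _ =
    [set w : pathsp A | w (Posz 1) = x] `&` (pshift @^-1` (word n @^-1` [set s]))).
  apply: measurableI; first exact: measurable_coord.
  by rewrite -[X in measurable X]setTI; exact: measurable_pshift.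
by apply/seteqP; split => w /=; rewrite wordS => -[-> ->].
Qed.

End word.

Section process.
Context {R : realType} {A : pointedType} (cA : countable [set: A]).
Context (P : probability (pathsp A) R).
Implicit Types (w : pathsp A) (s : seq A).

Lemma measurable_fun_word d (T : sigmaRingType d) n (g : seq A -> T) :
  measurable_fun setT (fun w => g (word n w)).
Proof.
exact: (measurable_fun_discrete (countable_seq cA) (@measurable_word A n)).
Qed.

Lemma measurable_word_preimage n (B : set (seq A)) :
  measurable (word n @^-1` B).
Proof.
exact: (measurable_preimage_discrete (countable_seq cA) (@measurable_word A n)).
Qed.

Definition pr s : R := fine (P (word (size s) @^-1` [set s])).

Lemma prE n s : size s = n -> (pr s)%:E = P (word n @^-1` [set s]).
Proof.
by move=> <-; rewrite /pr fineK// fin_num_measure//; exact: measurable_word.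
Qed.

Lemma pr01 s : 0 <= pr s <= 1.
Proof.
rewrite -!lee_fin (prE erefl) measure_ge0/=.
by rewrite probability_le1//; exact: measurable_word.
Qed.

Lemma pr_ge0 s : 0 <= pr s. Proof. by case/andP: (pr01 s). Qed.

Lemma nln_pr_ge0 s : 0 <= - ln (pr s).
Proof. by rewrite oppr_ge0 ln_le0//; case/andP: (pr01 s). Qed.

Lemma blockprobE n (x : n.-tuple A) : blockprob P x = pr x.
Proof. by rewrite /blockprob cyltE /pr size_tuple. Qed.

Definition mass (f : seq A -> \bar R) n := (\esum_(s in [set s | size s = n]) f s)%E.

Lemma integral_word n (g : seq A -> R) : (forall s, 0 <= g s) ->
  (\int[P]_w (g (word n w))%:E = mass (fun s => (g s * pr s)%:E) n)%E.
Proof.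
move=> g0.
rewrite (integral_discrete _ (countable_seq cA) (@measurable_word A n) (g := EFin \o g))//.
rewrite /mass [RHS]esum_mkcond; apply: eq_esum => s _.
case: ifPn => [/set_mem/= sn|]; first by rewrite EFinM (prE sn).
move/negP => sn; rewrite (_ : _ @^-1` _ = set0) ?measure0 ?mule0//.
by apply/seteqP; split => // w /= ws; apply: sn; rewrite inE/= -ws size_word.
Qed.

Lemma mass_pr n : mass (fun s => (pr s)%:E) n = 1%E.
Proof.
have : (\int[P]_w cst 1 w = mass (fun s => (1 * pr s)%:E) n)%E.
  exact: (@integral_word n (cst 1) (fun=> ler01)).
rewrite integral_cst//.
rewrite [X in (_ * X)%E](probability_setT P) mule1 => ->.
by apply: eq_esum => s _; rewrite mul1r.
Qed.

Lemma esum_tuple n (f : seq A -> \bar R) :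
  \esum_(x in [set: n.-tuple A]) f x = mass f n.
Proof.
rewrite /mass (reindex_esum [set: n.-tuple A] _ (@tval n A))//; split.
- by move=> x _ /=; rewrite size_tuple.
- by move=> x y _ _; exact: val_inj.
- by move=> s /= sn; exists (tcast sn (in_tuple s)) => //; rewrite val_tcast.
Qed.

Lemma block_entropyE n : block_entropy P n = (\int[P]_w (- ln (pr (word n w)))%:E)%E.
Proof.
rewrite (integral_word _ nln_pr_ge0) -esum_tuple.
by apply: eq_esum => x _; rewrite blockprobE mulNr mulrC.
Qed.

Lemma mass_cat n m (f : seq A -> \bar R) : (forall s, 0 <= f s)%E ->
  mass f (n + m) = mass (fun u => mass (fun v => f (u ++ v)) m) n.
Proof.
move=> f0; rewrite /mass esum_esum//.
rewrite (reindex_esum ([set s | size s = n] `*`` (fun=> [set s | size s = m])) _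
  (fun u => u.1 ++ u.2))//; split.
- by move=> [u v] /= [un vm]; rewrite size_cat un vm.
- move=> [u v] [u' v'] /set_mem[/= un vm] /set_mem[/= un' vm'] /eqP.
  by rewrite eqseq_cat ?un ?un'// => /andP[/eqP -> /eqP ->].
- move=> s /= snm; exists (take n s, drop n s); last by rewrite /= cat_take_drop.
  by split => /=; [rewrite size_takel// snm leq_addr|rewrite size_drop snm addKn].
Qed.

Lemma mass1 (f : seq A -> \bar R) : mass f 1 = \esum_(x in [set: A]) f [:: x].
Proof.
rewrite /mass (reindex_esum [set: A] _ (fun x => [:: x]))//; split => //.
- by move=> x y _ _ [].
- by move=> [|x []] //= _; exists x.
Qed.

Lemma massZl n c (f : seq A -> R) : 0 <= c -> (forall s, 0 <= f s) ->
  mass (fun s => (c * f s)%:E) n = (c%:E * mass (fun s => (f s)%:E) n)%E.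
Proof.
by move=> c0 f0; rewrite /mass -esumZl.
Qed.

Lemma mass_le n (f g : seq A -> \bar R) : (forall s, size s = n -> (f s <= g s)%E) ->
  (mass f n <= mass g n)%E.
Proof. by move=> fg; apply: le_esum. Qed.

Lemma mass0 (f : seq A -> \bar R) : (0 <= f [::])%E -> mass f 0 = f [::].
Proof.
move=> f0; rewrite /mass (_ : [set s | size s = 0%N] = [set [::]]) ?esum_set1//.
by apply/seteqP; split => [[]|_ ->].
Qed.

(** Gibbs' inequality read as a coding bound. It is applied to a product of block laws, to weights
    on single letters and to the renewal weights. *)
Lemma block_entropy_le n (q : seq A -> R) : (forall s, 0 <= q s <= 1) ->
  (forall s, 0 < pr s -> 0 < q s) -> (mass (fun s => (q s)%:E) n <= 1)%E ->
  (block_entropy P n <= \int[P]_w (- ln (q (word n w)))%:E)%E.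
Proof.
move=> q01 q0 q1; rewrite block_entropyE.
rewrite (integral_word _ nln_pr_ge0) (@integral_word _ (fun s => - ln (q s))); last first.
  by move=> s; rewrite oppr_ge0 ln_le0//; case/andP: (q01 s).
have /(_ pr01 q01 q0 (mass_pr n) q1) := @gibbs R _ [set s | size s = n] pr q.
rewrite /mass; under eq_esum do rewrite mulrC -mulNr.
by under [X in (_ <= X)%E -> _]eq_esum do rewrite mulrC -mulNr.
Qed.

End process.

(** * Greedy parsing and the ergodic theorem *)

(** Parse from the left: if a good block starts here and more than [M] letters remain, use it at
    rate [c]; otherwise advance by one letter, which costs [b] extra. The extra cost is thus paid
    only outside [G] or among the last [M] positions, whence the two terms of the factor. *)
Lemma greedy_cover (W : Type) (R : realType) (T : W -> W) (phi : nat -> W -> R)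
    (b : W -> R) (c : R) (M : nat) (G : set W) :
  (forall w, 0 <= b w) -> (forall w, phi 0%N w <= 0) ->
  (forall N w, phi N.+1 w <= c + b w + phi N (T w)) ->
  (forall w, G w -> exists2 n, (0 < n <= M)%N &
    forall N, (n <= N)%N -> phi N w <= n%:R * c + phi (N - n)%N (iter n T w)) ->
  forall N w, phi N w <= N%:R * c +
    \sum_(0 <= i < N) b (iter i T w) * (\1_(~` G) (iter i T w) + (N <= i + M)%N%:R).
Proof.
move=> b0 phi0 phiS phiG; elim/ltn_ind => -[|N] IH w.
  by rewrite big_nil mul0r addr0.
have term_ge0 K i v : 0 <= b v * (\1_(~` G) v + (K <= i + M)%N%:R).
  by rewrite mulr_ge0// addr_ge0.
have shiftE n i : iter (i + n) T w = iter i T (iter n T w) by rewrite iterD.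
case: (boolP ((w \in ~` G) || (N < M)%N)) => [single|].
  apply: (le_trans (phiS N w)).
  rewrite big_nat_recl//= add0n.
  have coef : 1 <= \1_(~` G) w + (N < M)%N%:R :> R.
    case/orP: single => [wG|->]; first by rewrite indicE wG lerDl.
    by rewrite lerDr indicE.
  have := IH N (ltnSn N) (T w).
  rewrite (eq_bigr (fun i => b (iter i T (T w)) *
     (\1_(~` G) (iter i T (T w)) + (N < i.+1 + M)%N%:R))); last first.
    by move=> i _; rewrite addSn ltnS.
  have := ler_wpM2l (b0 w) coef; rewrite mulr1.
  under eq_bigr do rewrite -iterSr.
  by rewrite -[in (N.+1)%:R]natr1 mulrDl mul1r /=; lra.
rewrite negb_or -leqNgt => /andP[/negP wG MN].
have [|n /andP[n0 nM] phin] := phiG w.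
  by apply: contrapT => nG; apply: wG; rewrite inE.
have nN : (n <= N.+1)%N by rewrite (leq_trans nM)// ltnW.
apply: (le_trans (phin _ nN)).
have NnN : (N.+1 - n < N.+1)%N by rewrite ltn_subrL n0.
apply: (@le_trans _ _ (n%:R * c + ((N.+1 - n)%:R * c +
    \sum_(0 <= i < N.+1 - n) b (iter i T (iter n T w)) *
      (\1_(~` G) (iter i T (iter n T w)) + (N.+1 - n <= i + M)%N%:R)))).
  by rewrite lerD2l; exact: IH.
rewrite addrA -mulrDl -natrD subnKC// lerD2l.
(* The first [n] summands, inside the block just used, are dropped as nonnegative; the others are
   those of the parsing from [iter n T w]. *)
rewrite [leRHS](@big_cat_nat _ _ _ n)//= -[leLHS]add0r lerD ?sumr_ge0//.
rewrite -[X in _ <= \sum_(X <= i < _) _](add0n n) big_addn; apply: ler_sum => i _.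
by rewrite shiftE addnAC leq_subLR (addnC n).
Qed.

Section ergodic.
Context d (W : measurableType d) (R : realType) (P : probability W R) (T : W -> W).
Hypothesis mT : measurable_fun setT T.
Hypothesis PT : forall E, measurable E -> P (T @^-1` E) = P E.

Let mTi n : measurable_fun setT (iter n T).
Proof.
elim: n => [|n IH]; first exact: measurable_id.
exact: (measurableT_comp mT IH).
Qed.

Lemma measure_preimage_iter n E : measurable E -> P (iter n T @^-1` E) = P E.
Proof.
move=> mE; elim: n => // n IH.
rewrite -[RHS]IH -[RHS]PT; last by rewrite -[X in measurable X]setTI; exact: mTi.
by congr (P _); apply/seteqP; split => w /=; rewrite -iterS iterSr.
Qed.

Lemma integral_iter n (f : W -> \bar R) : measurable_fun setT f ->
  (forall w, 0 <= f w)%E -> (\int[P]_w f (iter n T w) = \int[P]_w f w)%E.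
Proof.
move=> mf f0; transitivity (\int[pushforward P (iter n T)]_w f w)%E.
  by rewrite ge0_integral_pushforward.
by apply: eq_measure_integral => E mE _; exact: measure_preimage_iter.
Qed.

Hypothesis ergT : forall E, measurable E -> T @^-1` E = E -> P E = 0%E \/ P E = 1%E.

(* The increasing union of the preimages of E is strictly invariant and has the measure of E. *)
Lemma ergodic_subinvariant E : measurable E -> E `<=` T @^-1` E ->
  P E = 0%E \/ P E = 1%E.
Proof.
move=> mE ET; pose F n := iter n T @^-1` E.
have mF n : measurable (F n) by rewrite -[X in measurable X]setTI; exact: mTi.
have FS n : F n `<=` F n.+1 by move=> w /ET.
have ndF : {homo F : n m / (n <= m)%N >-> (n <= m)%O}.
  by apply/nondecreasing_seqP => n; rewrite subsetEset; exact: FS.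
have mU : measurable (\bigcup_n F n) by exact: bigcup_measurable.
have PU : P (\bigcup_n F n) = P E.
  apply: (cvg_unique (@ereal_hausdorff R) (nondecreasing_cvg_mu mF mU ndF)).
  by apply: cvg_near_cst; apply: nearW => n; exact: measure_preimage_iter.
rewrite -PU; apply: ergT => //; apply/seteqP; split => [w [n _]|w [n _]].
  by rewrite /F /= -iterSr => nw; exists n.+1.
by move=> nw; exists n => //; move: (FS _ _ nw); rewrite /F /preimage/= -iterSr.
Qed.

Lemma ae_prob1 E : measurable E -> P E = 1%E -> {ae P, forall w, E w}.
Proof.
move=> mE PE; exists (~` E); split => //; first exact: measurableC.
by rewrite probability_setC// PE subee.
Qed.

Section packing.
Variables (phi : nat -> W -> R) (b : W -> R) (c : R) (good : nat -> set W).
Hypothesis mb : measurable_fun setT b.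
Hypothesis b0 : forall w, 0 <= b w.
Hypothesis ib : (\int[P]_w (b w)%:E < +oo)%E.
Hypothesis phi0 : forall w, phi 0%N w <= 0.
Hypothesis phiS : forall N w, phi N.+1 w <= c + b w + phi N (T w).
Hypothesis mgood : forall n, measurable (good n).
Hypothesis phi_good : forall n N w, good n w -> (0 < n <= N)%N ->
  phi N w <= n%:R * c + phi (N - n)%N (iter n T w).
Hypothesis ae_good : {ae P, forall w, exists2 n, (0 < n)%N & good n w}.

Let G M := \bigcup_(n in [set n | (0 < n <= M)%N]) good n.

Let mG M : measurable (G M). Proof. exact: bigcup_measurable. Qed.

Let mEFin (f : W -> R) : measurable_fun setT f -> measurable_fun setT (EFin \o f).
Proof. by move=> mf; apply/measurable_EFinP. Qed.

Let bG M w := b w * \1_(~` G M) w.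

Let bG_ge0 M w : 0 <= bG M w. Proof. by rewrite mulr_ge0. Qed.

Let mbG M : measurable_fun setT (bG M).
Proof.
apply: measurable_funM => //; apply: measurable_indic; exact: measurableC.
Qed.

(** Almost every point lies in [G M] for [M] large, so [bG M] tends to 0 almost everywhere,
    dominated by the integrable [b]. *)
Let int_bG_cvg0 : (\int[P]_w (bG M w)%:E)%E @[M --> \oo] --> 0%E.
Proof.
have bint : P.-integrable setT (EFin \o b).
  apply/integrableP; split; first exact: mEFin.
  by rewrite (eq_integral (EFin \o b))// => w _ /=; rewrite ger0_norm.
have [] := @dominated_convergence _ _ _ P setT measurableT
  (fun M w => (bG M w)%:E) (cst 0%E) (EFin \o b).
- by move=> M; exact: mEFin.
- exact: measurable_cst.
- apply: filterS ae_good => w [n n0 gn] _; apply: cvg_near_cst.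
  exists n => // M /= nM; rewrite /bG indicE memNset ?mulr0//=.
  by apply; exists n => //=; rewrite n0.
- exact: bint.
- apply: nearW => w M _ /=; rewrite lee_fin ger0_norm// /bG.
  by rewrite -[leRHS]mulr1 ler_wpM2l// indicE lern1 leq_b1.
by rewrite integral0.
Qed.

(** [M] is taken so large that the points where no good block of length at most [M] starts
    contribute at most [e] to the integral of [b]. The last [M] positions cost at most [M] times
    that integral, whatever [N] is. The ergodic theorem ([phi] minus a partial sum) and the packing
    code ([phi] a code length) are the two instances. *)
Lemma packing e : 0 < e -> exists C : R, forall N, exists B : W -> R,
  [/\ measurable_fun setT B, forall w, 0 <= B w,
     forall w, phi N w <= N%:R * c + B w &
     (\int[P]_w (B w)%:E <= (N%:R * e + C)%:E)%E].
Proof.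
move=> e0.
have [M bGM] : exists M, (\int[P]_w (bG M w)%:E <= e%:E)%E.
  have /fine_cvgP[[m1 _ fin] /cvgrPdist_le/(_ e e0)[m2 _ lim]] := int_bG_cvg0.
  exists (maxn m1 m2); move: (fin (maxn m1 m2) (leq_maxl _ _)) (lim (maxn m1 m2) (leq_maxr _ _)).
  move=> /= finM; rewrite sub0r normrN => /(le_trans (ler_norm _)) le.
  by rewrite -(fineK finM) lee_fin.
pose C := fine (\int[P]_w (b w)%:E).
have CE : (\int[P]_w (b w)%:E = C%:E)%E.
  by rewrite fineK// ge0_fin_numE//; apply: integral_ge0 => w _; rewrite lee_fin.
have C0 : 0 <= C by rewrite -lee_fin -CE; apply: integral_ge0 => w _; rewrite lee_fin.
exists (M%:R * C) => N.
pose t i w := bG M w + b w * (N <= i + M)%N%:R.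
have t0 i w : 0 <= t i w by rewrite addr_ge0// mulr_ge0.
have mt i : measurable_fun setT (t i).
  by apply: measurable_funD => //; apply: measurable_funM.
have mtT i : measurable_fun setT (t i \o iter i T) by exact: measurableT_comp.
exists (fun w => \sum_(0 <= i < N) t i (iter i T w)); split.
- by apply: measurable_sum => i; exact: mtT.
- by move=> w; exact: sumr_ge0.
- move=> w; have := @greedy_cover _ _ T phi b c M (G M) b0 phi0 phiS _ N w.
  rewrite (eq_bigr (fun i => t i (iter i T w))); last first.
    by move=> i _; rewrite mulrDr.
  apply => {}w [n /andP[n0 nM] gn]; exists n; first by rewrite n0.
  by move=> K nK; apply: phi_good => //; rewrite n0.
under eq_integral do rewrite -sumEFin.
rewrite ge0_integral_sum//; last 2 first.
  - by move=> i; apply/measurable_EFinP; exact: mtT.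
  - by move=> i w _; rewrite lee_fin.
have intt i : (\int[P]_w (t i (iter i T w))%:E <= (e + C * (N <= i + M)%N%:R)%:E)%E.
  rewrite (@integral_iter i (fun w => (t i w)%:E)); last 2 first.
    by apply/measurable_EFinP; exact: mt.
    by move=> w; rewrite lee_fin.
  rewrite /t; under eq_integral do rewrite EFinD [X in (_ + X%:E)%E]mulrC [X in (_ + X)%E]EFinM.
  rewrite ge0_integralD//; last 4 first.
    - by move=> w _; rewrite lee_fin bG_ge0.
    - exact/mEFin/mbG.
    - by move=> w _; rewrite mule_ge0// lee_fin.
    - by apply: measurable_funeM; exact: mEFin.
  rewrite ge0_integralZl//; last 2 first.
    - exact: mEFin.
    - by move=> w _; rewrite lee_fin.
  by rewrite CE -EFinM EFinD leeD// mulrC.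
apply: (@le_trans _ _ (\sum_(0 <= i < N) (e + C * (N <= i + M)%N%:R)%:E)%E).
  exact: lee_sum.
rewrite sumEFin lee_fin big_split/= big_const_nat subn0 iter_addr_0 -[e *+ N]mulr_natl lerD2l.
rewrite -mulr_sumr mulrC ler_wpM2r// -natr_sum ler_nat.
(* At most [M] indices [i < N] satisfy [N <= i + M]. *)
elim: N {t t0 mt mtT intt} => [|N IH]; first by rewrite big_nil.
rewrite big_nat_recl// add0n; have [NM|MN] := ltnP N M.
  apply: (@leq_trans (1 + \sum_(0 <= i < N) 1)%N); last first.
    by rewrite sum_nat_const_nat muln1 subn0.
  by rewrite leq_add// leq_sum// => i _; exact: leq_b1.
by rewrite add0n; under eq_bigr do rewrite addSn ltnS.
Qed.
End packing.

(** Let [E] be the set where the sums exceed [n * (m + e)] by arbitrarily much. It is subinvariant,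
    so it has measure 0 or 1. In the second case almost every point starts a block of average at
    least [m + e]; packing such blocks and integrating contradicts the mean bound [m]. *)
Lemma ergodic_average_le (g : W -> R) (m e : R) :
  measurable_fun setT g -> (forall w, 0 <= g w) -> (\int[P]_w (g w)%:E <= m%:E)%E ->
  0 < e ->
  {ae P, forall w, exists K : nat, forall n,
     \sum_(0 <= i < n) g (iter i T w) <= n%:R * (m + e) + K%:R}.
Proof.
move=> mg g0 gm e0.
pose S n w := \sum_(0 <= i < n) g (iter i T w).
have SS n w : S n.+1 w = g w + S n (T w).
  by rewrite /S big_nat_recl//=; congr (_ + _); apply: eq_bigr => i _; rewrite -iterSr.
have mS n : measurable_fun setT (S n).
  by apply: measurable_sum => i; exact: measurableT_comp.
have S0 n w : 0 <= S n w by exact: sumr_ge0.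
pose F K n := [set w | n%:R * (m + e) + K%:R < S n w].
have mF K n : measurable (F K n).
  rewrite (_ : F K n = setT `&` S n @^-1` `]n%:R * (m + e) + K%:R, +oo[%classic).
    exact: mS.
  by rewrite setTI; apply/seteqP; split => w; rewrite /F/= in_itv/= andbT.
pose E := \bigcap_(K : nat) \bigcup_n F K n.
have mE : measurable E.
  by apply: bigcapT_measurable => K; exact: bigcupT_measurable.
have ET : E `<=` T @^-1` E.
  (* [K'] absorbs the dropped term [g w] and the change of the threshold by one [m + e]. *)
  move=> w Ew K _; pose K' := Num.Def.archi_bound (`|m + e| + g w).
  have K'gt : `|m + e| + g w < K'%:R by apply: archi_boundP; exact: addr_ge0.
  have [[|n] _] := Ew (K + K')%N I; rewrite /F /= natrD.
    rewrite /S big_nil mul0r add0r => /lt_le_trans/(_ (lexx _)) h.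
    by have : (0 : R) <= K%:R + K'%:R by []; rewrite leNgt h.
  rewrite SS -natr1 mulrDl mul1r => h; exists n => //=.
  by have := ler_norm (- (m + e)); rewrite normrN; lra.
have [PE|PE] := ergodic_subinvariant mE ET.
  exists E; split => // w /= nw; apply: contrapT => nE; apply: nw.
  move/existsNP : nE => [K /not_implyP[_ nE]]; exists K => n.
  by rewrite leNgt; apply/negP => lt; apply: nE; exists n.
exfalso.
have [C hC] : exists C : R, forall N, exists B : W -> R,
  [/\ measurable_fun setT B, forall w, 0 <= B w,
     forall w, - S N w <= N%:R * (- (m + e)) + B w &
     (\int[P]_w (B w)%:E <= (N%:R * (e / 2) + C)%:E)%E].
  (* Large sums are low costs: the cost is [- S] at rate [- (m + e)], and the surcharge [|m + e|]
     pays for a single step since [g] is nonnegative. *)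
  apply: (@packing (fun N w => - S N w) (cst `|m + e|) (- (m + e))
    (fun n => [set w | n%:R * (m + e) <= S n w])).
  - exact: measurable_cst.
  - by move=> w /=.
  - rewrite (eq_integral (cst `|m + e|%:E))// integral_cst//.
    by rewrite [X in (_ * X)%E](probability_setT P) mule1 ltry.
  - by move=> w; rewrite /S big_nil oppr0.
  - by move=> N w; rewrite SS /=; have := ler_norm (m + e); have := g0 w; lra.
  - move=> n; rewrite (_ : [set w | _] = setT `&` S n @^-1` `[n%:R * (m + e), +oo[%classic).
      exact: mS.
    by rewrite setTI; apply/seteqP; split => w; rewrite /= in_itv/= andbT.
  - move=> n N w /= nS /andP[n0 nN].
    have -> : S N w = S n w + S (N - n)%N (iter n T w).
      rewrite /S (@big_cat_nat _ _ _ n)//=; congr (_ + _).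
      rewrite -[X in \sum_(X <= _ < _) _](add0n n) big_addn.
      by apply: eq_bigr => i _; rewrite iterD.
    lra.
  - apply: filterS (ae_prob1 mE PE) => w /(_ 0%N I)[[|n] _]; rewrite /F /= addr0.
      by rewrite /S big_nil mul0r ltxx.
    by move=> /ltW lt; exists n.+1.
  - by rewrite divr_gt0.
have m0 : 0 <= m.
  by rewrite -lee_fin (le_trans _ gm)//; apply: integral_ge0 => w _; rewrite lee_fin.
have intS N : (\int[P]_w (S N w)%:E <= (N%:R * m)%:E)%E.
  under eq_integral do rewrite -sumEFin.
  rewrite ge0_integral_sum//; last 2 first.
    - by move=> i; apply/measurable_EFinP; exact: measurableT_comp.
    - by move=> i w _; rewrite lee_fin.
  rewrite (eq_bigr (fun=> \int[P]_w (g w)%:E)%E); last first.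
    move=> i _; rewrite (@integral_iter i (fun w => (g w)%:E))//.
    exact/measurable_EFinP.
  apply: (@le_trans _ _ (\sum_(0 <= i < N) m%:E)%E); first exact: lee_sum.
  by rewrite sumEFin lee_fin big_const_nat subn0 iter_addr_0 mulr_natl.
(* Integrating the packing bound gives [N * (m + e) <= N * m + N * (e / 2) + C], which is absurd for
   large [N]. *)
have key N : N%:R * (e / 2) <= C.
  have [B [mB B0 SB intB]] := hC N.
  suff : ((N%:R * (m + e))%:E <= (N%:R * m + (N%:R * (e / 2) + C))%:E)%E.
    by rewrite lee_fin; lra.
  rewrite EFinD; apply: (le_trans _ (leeD (intS N) intB)).
  rewrite -ge0_integralD//; last 4 first.
    - by move=> w _; rewrite lee_fin.
    - exact/measurable_EFinP.
    - by move=> w _; rewrite lee_fin.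
    - exact/measurable_EFinP.
  rewrite -[leLHS]mule1 -[X in (_ * X <= _)%E](probability_setT P) -integral_cst//.
  apply: ge0_le_integral => //.
  - by move=> w _; rewrite lee_fin mulr_ge0// addr_ge0// ltW.
  - by under eq_fun do rewrite -EFinD; apply/measurable_EFinP; exact: measurable_funD.
  - by move=> w _; rewrite -EFinD lee_fin; have := SB w; lra.
have C0 : 0 <= C by have := key 0%N; rewrite mul0r.
have /archi_boundP : 0 <= C / (e / 2) by rewrite divr_ge0// ltW// divr_gt0.
by rewrite ltr_pdivrMr ?divr_gt0// ltNge key.
Qed.

End ergodic.

(** * Subadditive sequences and elementary estimates *)

Lemma fekete (R : realType) (u : nat -> R) :
  (forall n m, u (n + m)%N <= u n + u m) -> (forall n, 0 <= u n) ->
  exists2 L, forall n, n%:R * L <= u n & (fun n => n%:R^-1 * u n) @ \oo --> L.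
Proof.
(* Indices are shifted to avoid division by zero. The limit is the infimum of [U], as Euclidean
   division of [n] by a near-optimal length [k.+1] shows. *)
move=> uD u0; pose U := [set (n.+1%:R^-1 * u n.+1) | n in [set: nat]].
have Ulb : has_inf U.
  split; first by exists (1%:R^-1 * u 1%N); exists 0%N.
  by exists 0 => _ [n _ <-]; rewrite mulr_ge0// invr_ge0.
have leU n : (0 < n)%N -> inf U <= n%:R^-1 * u n.
  by case: n => // n _; apply: ge_inf; [case: Ulb|exists n].
have leL n : n%:R * inf U <= u n.
  case: n => [|n]; first by rewrite mul0r.
  by rewrite -ler_pdivlMl// leU.
exists (inf U) => //; apply/cvgrPdist_le => e e0.
have [_ [k _ <-] uk] := inf_adherent (divr_gt0 e0 (ltr0Sn R 1)) Ulb.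
pose C := \sum_(0 <= r < k.+1) u r.
have uq q r : u (q * k.+1 + r)%N <= q%:R * u k.+1 + u r.
  elim: q => [|q IH]; first by rewrite mul0r add0r.
  rewrite mulSn -addnA (le_trans (uD _ _))// -natr1 mulrDl mul1r.
  by move: IH; lra.
have C0 : 0 <= C by exact: sumr_ge0.
exists (Num.Def.archi_bound (C / (e / 2))).+1 => // n /= Cn.
have n0 : (0 < n)%N by exact: leq_ltn_trans Cn.
have n0R : 0 < n%:R :> R by rewrite ltr0n.
rewrite ler0_norm ?subr_le0 ?leU// opprB lerBlDl.
have Cle : n%:R^-1 * C <= e / 2.
  rewrite ler_pdivrMl// -ler_pdivrMr ?divr_gt0//.
  apply: (@le_trans _ _ (Num.Def.archi_bound (C / (e / 2)))%:R).
    by apply/ltW/archi_boundP; rewrite divr_ge0// divr_ge0// ltW.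
  by rewrite ler_nat ltnW.
have un : u n <= (n %/ k.+1)%:R * u k.+1 + C.
  rewrite {1}(divn_eq n k.+1); apply: (le_trans (uq _ _)); rewrite lerD2l /C.
  rewrite (bigD1_seq (n %% k.+1)%N) ?iota_uniq//=; last by rewrite mem_index_iota ltn_mod.
  by rewrite lerDl sumr_ge0.
have dn : (n %/ k.+1)%:R * u k.+1 <= n%:R * (k.+1%:R^-1 * u k.+1).
  by rewrite mulrA ler_wpM2r// ler_pdivlMr// -natrM ler_nat leq_trunc_div.
apply: (@le_trans _ _ (n%:R^-1 * (n%:R * (k.+1%:R^-1 * u k.+1) + C))).
  by rewrite ler_wpM2l ?invr_ge0// (le_trans un)// lerD2r.
rewrite mulrDr mulKf ?gt_eqF//; apply: (le_trans (lerD (ltW uk) Cle)).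
by rewrite -addrA -splitr.
Qed.

(** The cubic term of the exponential series, with denominator 6, beats [n * n.+1 <= 2 * n ^ 2],
    whence the 12 in [K]. Polynomial factors of code weights are absorbed this way. *)
Lemma expR_ge_quadratic (R : realType) (e D : R) : 0 < e -> 0 <= D ->
  exists m, forall n, (m <= n)%N -> D * (n%:R * n.+1%:R) <= expR (n%:R * e).
Proof.
move=> e0 D0; pose K := 12 * D / e ^+ 3.
have K0 : 0 <= K by apply: divr_ge0; [exact: mulr_ge0|apply: exprn_ge0; exact: ltW].
exists (Num.Def.archi_bound K).+1 => n Kn.
have n1 : 1 <= n%:R :> R by rewrite ler1n (leq_trans _ Kn).
have ne0 : 0 <= n%:R * e by rewrite mulr_ge0// ltW.
have nK : K <= n%:R.
  by rewrite (le_trans (ltW (archi_boundP K0)))// ler_nat ltnW.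
apply: (le_trans _ (expR_ge1Dxn 2 ne0)).
rewrite (_ : 3`! = 6)%N// exprMn -[leLHS]add0r lerD//.
rewrite ler_pdivlMr//; move: nK; rewrite /K ler_pdivrMr ?exprn_gt0// => nK.
rewrite -natr1.
have := ler_wpM2l (sqr_ge0 (n%:R : R)) nK.
have : D * (n%:R * 1) <= D * (n%:R * n%:R) by rewrite ler_wpM2l// ler_wpM2l.
rewrite !exprS !expr0 !mulr1 ; set x := n%:R; set z := e * (e * e).
nra.
Qed.

Lemma telescope_inv (R : realType) N :
  \sum_(1 <= n < N.+1) (n%:R^-1 - n.+1%:R^-1) = 1 - N.+1%:R^-1 :> R.
Proof.
elim: N => [|N IH]; first by rewrite big_geq// invr1 subrr.
by rewrite big_nat_recr//= IH addrA subrK.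
Qed.

(** * Renewal weights *)

Section renewal.
Context {R : realType} {A : pointedType} (r : seq A -> R).
Implicit Types s : seq A.
Hypothesis r0 : forall s, 0 <= r s.

(* The total weight of all the ways of cutting s into nonempty blocks, a block u weighing r u.
   The fuel k only has to be at least the size of s. *)
Fixpoint renewal (k : nat) s : R :=
  if k is k'.+1 then
    if s is [::] then 1
    else \sum_(1 <= n < (size s).+1) r (take n s) * renewal k' (drop n s)
  else (nilp s)%:R.

Definition cutweight s := renewal (size s) s.

Lemma renewal_ge0 k s : 0 <= renewal k s.
Proof.
elim: k s => [|k IH] [|x s] //=.
by apply: sumr_ge0 => n _; rewrite mulr_ge0.
Qed.

Lemma renewalE k s : (size s <= k)%N -> renewal k s = cutweight s.
Proof.
elim/ltn_ind: k s => -[|k] IH [|x s] //= sk.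
rewrite /cutweight /= !big_nat; apply: eq_bigr => n /andP[].
case: n => // n _ nk /=.
have ds : (size (drop n s) <= size s)%N by rewrite size_drop leq_subr.
by rewrite (IH k)// ?(leq_trans ds)// (IH (size s)).
Qed.

Lemma cutweight_nil : cutweight [::] = 1. Proof. by []. Qed.

Lemma cutweight_ge0 s : 0 <= cutweight s. Proof. exact: renewal_ge0. Qed.

(** Cutting off [u] first is one of the nonnegative terms of the sum. When the weights are positive,
    prepending a block thus lengthens the code by at most [- ln (r u)]. *)
Lemma cutweight_cat u s : u != [::] -> r u * cutweight s <= cutweight (u ++ s).
Proof.
case: u => // x u _; rewrite {2}/cutweight /= size_cat.
rewrite (bigD1_seq (size u).+1) ?iota_uniq//=; last by rewrite mem_index_iota/= ltnS leq_addr.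
rewrite take_size_cat// drop_size_cat// renewalE ?leq_addl// lerDl.
by apply: sumr_ge0 => n _; rewrite mulr_ge0// renewal_ge0.
Qed.

Lemma cutweight_gt0 : (forall x, 0 < r [:: x]) -> forall s, 0 < cutweight s.
Proof.
move=> r1; elim=> [|x s IH]; first by rewrite cutweight_nil.
by apply: lt_le_trans (@cutweight_cat [:: x] s isT); rewrite mulr_gt0.
Qed.

(** Split words by their first block: the mass at a positive length is at most a sum over [n] of the
    mass of [r] at [n] times a mass at the remaining length, which is at most 1 by induction on the
    fuel. *)
Lemma mass_renewal :
  (forall N, \sum_(1 <= n < N.+1) mass (fun s => (r s)%:E) n <= 1)%E ->
  forall k N, (mass (fun s => (renewal k s)%:E) N <= 1)%E.
Proof.
move=> r1; elim=> [|k IH] [|N].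
- by rewrite mass0.
- rewrite /mass esum1// => -[|x s] //.
- by rewrite mass0.
apply: le_trans (r1 N.+1).
apply: (@le_trans _ _ (\sum_(1 <= n < N.+2)
    mass (fun s => (r (take n s) * renewal k (drop n s))%:E) N.+1)%E).
  rewrite -esum_sum; last first.
    by move=> s n _ _; rewrite lee_fin mulr_ge0// renewal_ge0.
  apply: le_esum => -[|x s] //= [<-]; rewrite -sumEFin.
  by [].
rewrite !big_nat; apply: lee_sum => n /andP[n1 nN].
rewrite -{1}(@subnKC n N.+1)// mass_cat; last by move=> s; rewrite lee_fin mulr_ge0// renewal_ge0.
apply: mass_le => u un.
rewrite -[leRHS]mule1.
apply: le_trans (lee_wpmul2l _ (IH (N.+1 - n)%N)); last by rewrite lee_fin.
rewrite -massZl//; last exact: renewal_ge0.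
by apply: mass_le => v _; rewrite take_size_cat// drop_size_cat.
Qed.

Lemma mass_cutweight :
  (forall N, \sum_(1 <= n < N.+1) mass (fun s => (r s)%:E) n <= 1)%E ->
  forall N, (mass (fun s => (cutweight s)%:E) N <= 1)%E.
Proof.
move=> r1 N; apply: le_trans (mass_renewal r1 N N).
by apply: mass_le => s sN; rewrite renewalE// sN.
Qed.

End renewal.

(** * Entropy rate *)

Section entropy.
Context {R : realType} {A : pointedType} (cA : countable [set: A]).
Context (P : probability (pathsp A) R) (sP : stationary P).
Implicit Types (w : pathsp A) (s : seq A).

Let H n := block_entropy P n.

Lemma pshift_invariant (E : set (pathsp A)) : measurable E -> P (pshift @^-1` E) = P E.
Proof. exact: sP. Qed.

Lemma pr_nil : pr P [::] = 1.
Proof.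
rewrite /pr (_ : _ @^-1` _ = setT); first by rewrite (probability_setT P).
by apply/seteqP; split.
Qed.

Lemma pr_catl u v : pr P (u ++ v) <= pr P u.
Proof.
rewrite -lee_fin (prE P (n := (size u + size v)%N)) ?size_cat// (prE P erefl).
rewrite le_measure// ?inE; try exact: measurable_word.
move=> w /=; rewrite wordD => /eqP.
by rewrite eqseq_cat ?size_word// => /andP[/eqP].
Qed.

Lemma pr_catr u v : pr P (u ++ v) <= pr P v.
Proof.
rewrite -lee_fin (prE P (n := (size u + size v)%N)) ?size_cat// (prE P erefl).
rewrite -[leRHS](measure_preimage_iter measurable_pshift pshift_invariant (size u)); last first.
  exact: measurable_word.
have mI : measurable (iter (size u) pshift @^-1` (word (size v) @^-1` [set v])).
  rewrite -[X in measurable X]setTI; apply: (measurable_iter_pshift (size u)) => //.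
  exact: measurable_word.
rewrite le_measure// ?inE//; first exact: measurable_word.
move=> w /=; rewrite wordD => /eqP.
by rewrite eqseq_cat ?size_word// => /andP[_ /eqP].
Qed.

Lemma block_entropy_ge0 n : (0 <= H n)%E.
Proof.
by rewrite /H block_entropyE//; apply: integral_ge0 => w _; rewrite lee_fin nln_pr_ge0.
Qed.

Lemma measurable_nln_pr n :
  measurable_fun setT (fun w => (- ln (pr P (word n w)))%:E).
Proof. exact: (measurable_fun_word cA n (fun s => (- ln (pr P s))%:E)). Qed.

(* Gibbs' inequality against the product of the laws of the two subblocks. *)
Lemma block_entropyD n m : (H (n + m) <= H n + H m)%E.
Proof.
pose q s := pr P (take n s) * pr P (drop n s).
have q01 s : 0 <= q s <= 1.
  rewrite mulr_ge0 ?pr_ge0// mulr_ile1 ?pr_ge0//.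
    by case/andP: (pr01 P (take n s)).
  by case/andP: (pr01 P (drop n s)).
apply: (@le_trans _ _ (\int[P]_w (- ln (q (word (n + m) w)))%:E)%E).
  apply: block_entropy_le => //.
  - move=> s ps; rewrite mulr_gt0// (lt_le_trans ps)// -[in leLHS](cat_take_drop n s).
      exact: pr_catl.
    exact: pr_catr.
  - rewrite mass_cat; last by move=> s; rewrite lee_fin mulr_ge0 ?pr_ge0.
    rewrite -[leRHS](mass_pr cA P n); apply: mass_le => u un.
    rewrite -[leRHS]mule1 -[in leRHS](mass_pr cA P m) -massZl; try exact: pr_ge0.
    by apply: mass_le => v _; rewrite /q take_size_cat// drop_size_cat.
rewrite /H !block_entropyE//.
rewrite -(integral_iter measurable_pshift pshift_invariant n (measurable_nln_pr m)); last first.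
  by move=> w; rewrite lee_fin nln_pr_ge0.
rewrite -ge0_integralD//; last 4 first.
  - by move=> w _; rewrite lee_fin nln_pr_ge0.
  - exact: measurable_nln_pr.
  - by move=> w _; rewrite lee_fin nln_pr_ge0.
  - exact: (measurableT_comp (measurable_nln_pr m) (measurable_iter_pshift n)).
apply: ge0_le_integral => //.
- by move=> w _; rewrite lee_fin oppr_ge0 ln_le0//; case/andP: (q01 (word (n + m) w)).
- exact: (measurable_fun_word cA (n + m) (fun s => (- ln (q s))%:E)).
- apply: emeasurable_funD; first exact: measurable_nln_pr.
  exact: (measurableT_comp (measurable_nln_pr m) (measurable_iter_pshift n)).
move=> w _; rewrite -EFinD lee_fin /q wordD take_size_cat ?size_word// drop_size_cat ?size_word//.
set a := pr P _; set b := pr P _.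
(* Since [ln 0 = 0], a null factor makes the left side 0 while the right side stays nonnegative. *)
have := pr_ge0 P (word n w); rewrite -/a le_eqVlt => /predU1P[<-|a0].
  by rewrite mul0r ln0// oppr0 add0r nln_pr_ge0.
have := pr_ge0 P (word m (iter n pshift w)); rewrite -/b le_eqVlt => /predU1P[<-|b0].
  by rewrite mulr0 ln0// oppr0 addr0 nln_pr_ge0.
by rewrite lnM// opprD.
Qed.

Hypothesis H1 : (block_entropy P 1 < +oo)%E.

Lemma block_entropy_fin n : H n \is a fin_num.
Proof.
rewrite ge0_fin_numE ?block_entropy_ge0//.
elim: n => [|n IH].
  rewrite /H block_entropyE// (eq_integral (cst 0%E)) ?integral0//.
  by move=> w _; rewrite /word/= pr_nil ln1 oppr0.
by rewrite -addn1 (le_lt_trans (block_entropyD _ _))// lte_add_pinfty.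
Qed.

(** Fekete's lemma for the block entropies, which are finite by subadditivity and [H1]. The limit is
    an infimum, hence the lower bound on every block entropy, to be contradicted by too short a
    code. *)
Lemma entropy_rateP : exists L : R, [/\ entropy_rate P = L%:E,
  forall n, ((n%:R * L)%:E <= H n)%E & (fun n => (n%:R^-1)%:E * H n)%E @ \oo --> L%:E].
Proof.
have [n m|n|L HL cvgL] := @fekete R (fun n => fine (H n)).
- rewrite -lee_fin EFinD !fineK ?block_entropy_fin//; exact: block_entropyD.
- by rewrite fine_ge0// block_entropy_ge0.
exists L.
have cL : (fun n => (n%:R^-1)%:E * H n)%E @ \oo --> L%:E.
  rewrite (_ : (fun n => _) = EFin \o (fun n => n%:R^-1 * fine (H n))).
    by apply/fine_cvgP; split; [exact: nearW|exact: cvgL].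
  by apply/funext => n /=; rewrite EFinM fineK// block_entropy_fin.
split => //; first exact: (cvg_lim (@ereal_hausdorff R) cL).
by move=> n; rewrite -[leRHS]fineK ?block_entropy_fin// lee_fin.
Qed.

End entropy.

(** * Lower bound on code lengths *)

Section smb.
Context {R : realType} {A : pointedType} (cA : countable [set: A]).
Context (P : probability (pathsp A) R) (sP : stationary P) (eP : ergodic P).
Implicit Types (w : pathsp A) (s : seq A).

(* Markov's inequality and Borel-Cantelli. *)
Lemma barron (q : seq A -> R) : (forall s, 0 <= q s) ->
  (forall n, mass (fun s => (q s)%:E) n <= 1)%E ->
  {ae P, forall w, exists m, forall n, (m <= n)%N ->
     q (word n w) <= n%:R * n.+1%:R * pr P (word n w)}.
Proof.
move=> q0 q1.
pose B (n : nat) : set (seq A) := [set s | n%:R * n.+1%:R * pr P s < q s].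
pose F n := word n.+1 @^-1` B n.+1.
have mF n : measurable (F n) by exact: (measurable_word_preimage cA).
(* Markov's inequality: on [F n] the weight [q] exceeds [n.+1 * n.+2] times the probability. The
   reciprocal is written as a difference so that the series telescopes. *)
have PF n : (P (F n) <= (n.+1%:R^-1 - n.+2%:R^-1)%:E)%E.
  have -> : P (F n) = (\int[P]_w (\1_(B n.+1) (word n.+1 w))%:E)%E.
    by rewrite -[in LHS](setIT (F n)) -integral_indic.
  rewrite (integral_word cA) => [|s]; last by rewrite indicE.
  have a0 : 0 <= n.+1%:R^-1 - n.+2%:R^-1 :> R.
    by rewrite subr_ge0 lef_pV2 ?posrE// ler_nat.
  rewrite -[leRHS]mule1.
  apply: le_trans (lee_wpmul2l _ (q1 n.+1)); last by rewrite lee_fin.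
  rewrite -massZl//; apply: mass_le => s _; rewrite lee_fin indicE.
  case: (boolP (s \in B n.+1)) => [/set_mem/= /ltW sB|_]; last by rewrite mul0r mulr_ge0.
  rewrite mul1r (_ : _ - _ = (n.+1%:R * n.+2%:R)^-1).
    by rewrite mulrC ler_pdivlMr ?mulr_gt0// mulrC.
  have x0 : (0 : R) < n.+1%:R by [].
  by rewrite -[n.+2%:R]natr1; move: n.+1%:R x0 => x x0; field; rewrite !gt_eqF// addr_gt0.
have sumPF : (\sum_(0 <= n <oo) P (F n) < +oo)%E.
  apply: (@le_lt_trans _ _ 1%E); last by rewrite ltry.
  apply: lime_le; first exact: is_cvg_nneseries.
  apply: nearW => N /=.
  apply: (@le_trans _ _ (\sum_(0 <= n < N) (n.+1%:R^-1 - n.+2%:R^-1)%:E)%E).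
    exact: lee_sum.
  rewrite sumEFin lee_fin (_ : \sum_(0 <= n < N) _ = 1 - N.+1%:R^-1).
    by rewrite lerBlDr lerDl invr_ge0.
  by rewrite -telescope_inv big_add1.
exists (lim_sup_set F); split.
- by apply: bigcapT_measurable => n; exact: bigcup_measurable.
- exact: lim_sup_set_cvg0.
move=> w /= nw m _; apply: contrapT => nF; apply: nw.
exists m.+1 => -[|n] // mn; rewrite leNgt; apply/negP => lt.
by apply: nF; exists n.
Qed.

Context (nu : A -> R) (nu0 : forall x, 0 < nu x).
Hypothesis nu1 : (\esum_(x in [set: A]) (nu x)%:E <= 1)%E.
Hypothesis inu : (\int[P]_w (- ln (nu (w (Posz 1))))%:E < +oo)%E.

Lemma nu_le1 x : nu x <= 1.
Proof.
rewrite -lee_fin; apply: le_trans nu1; apply: esum_ge.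
by exists [set x]; [split|rewrite fsbig_set1].
Qed.

(** Gibbs' inequality against [nu], whose mean code length is finite. *)
Lemma block_entropy1_fin : (block_entropy P 1 < +oo)%E.
Proof.
pose q s := nu (head point s).
apply: (@le_lt_trans _ _ (\int[P]_w (- ln (q (word 1 w)))%:E)%E); last first.
  by rewrite (eq_integral (fun w => (- ln (nu (w (Posz 1))))%:E)).
apply: block_entropy_le => //.
- by move=> s; apply/andP; split; [exact/ltW/nu0|exact: nu_le1].
- by move=> s _; exact: nu0.
by rewrite mass1.
Qed.

(* The weight of a block in the Ornstein-Weiss packing code: its probability, with a prior over
   block lengths, or nu on a single letter. *)
Let r s : R :=
  ((0 < size s)%N%:R * ((size s)%:R^-1 - (size s).+1%:R^-1) * pr P s +
   (size s == 1%N)%:R * nu (head point s)) / 2.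

Let a0 n : (0 < n)%N -> 0 <= n%:R^-1 - n.+1%:R^-1 :> R.
Proof. by move=> n0; rewrite subr_ge0 lef_pV2 ?posrE ?ltr0n// ler_nat. Qed.

Let r0 s : 0 <= r s.
Proof.
rewrite divr_ge0// addr_ge0//; last by rewrite mulr_ge0// ltW.
by case: s => [|x s]; rewrite ?mul0r// mul1r mulr_ge0 ?pr_ge0 ?a0.
Qed.

Let r_letter x : nu x / 2 <= r [:: x].
Proof.
by rewrite ler_wpM2r ?invr_ge0// /= !mul1r lerDr mulr_ge0 ?pr_ge0 ?a0.
Qed.

Let r_block s : s != [::] -> pr P s / (2 * ((size s)%:R * (size s).+1%:R)) <= r s.
Proof.
case: s => // x s _; rewrite /r; set n := size (x :: s).
have n0 : (0 : R) < n%:R by [].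
apply: (@le_trans _ _ ((n%:R^-1 - n.+1%:R^-1) * pr P (x :: s) / 2)); last first.
  by rewrite ler_wpM2r ?invr_ge0// mul1r lerDl mulr_ge0// ltW.
rewrite -[n.+1%:R]natr1 le_eqVlt; apply/orP; left; apply/eqP.
by move: (pr P _) n%:R n0 => p y y0; field; rewrite !gt_eqF// addr_gt0.
Qed.

(** The prior on block lengths telescopes to at most 1 and [nu] adds at most 1 at length 1; the
    division by 2 in [r] compensates for having both. *)
Let mass_r N : (\sum_(1 <= n < N.+1) mass (fun s => (r s)%:E) n <= 1)%E.
Proof.
pose t n : R := (n%:R^-1 - n.+1%:R^-1) / 2 + (n == 1%N)%:R / 2.
have mr n : (0 < n)%N -> (mass (fun s => (r s)%:E) n <= (t n)%:E)%E.
  move=> n0.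
  apply: (@le_trans _ _ (mass (fun s => ((n%:R^-1 - n.+1%:R^-1) / 2 * pr P s)%:E +
      ((n == 1%N)%:R / 2 * nu (head point s))%:E)%E n)).
    by apply: mass_le => s sn; rewrite /r sn n0 mul1r mulrDl mulrAC [X in _ + X]mulrAC EFinD.
  have a20 : 0 <= (n%:R^-1 - n.+1%:R^-1) / 2 :> R by rewrite divr_ge0 ?a0.
  have a30 : 0 <= (n == 1%N)%:R / 2 :> R by rewrite divr_ge0.
  rewrite /mass esumD; last 2 first.
    - by move=> s _; rewrite lee_fin mulr_ge0// pr_ge0.
    - by move=> s _; rewrite lee_fin mulr_ge0// ltW.
  rewrite -/(mass (fun s => (_ * pr P s)%:E) n) massZl//; last exact: pr_ge0.
  rewrite mass_pr// mule1 -/(mass (fun s => (_ * nu (head point s))%:E) n) massZl//; last first.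
    by move=> s; rewrite ltW.
  rewrite /t EFinD leeD2l//; case: eqP => [->|_]; last by rewrite mul0r mul0e.
  by rewrite mass1 -[leRHS]mule1 lee_wpmul2l// lee_fin.
apply: (@le_trans _ _ (\sum_(1 <= n < N.+1) (t n)%:E)%E).
  by rewrite !big_nat; apply: lee_sum => n /andP[n0 _]; exact: mr.
rewrite sumEFin lee_fin big_split/= -!mulr_suml telescope_inv.
have : \sum_(1 <= n < N.+1) (n == 1%N)%:R <= 1 :> R.
  case: N => [|N]; first by rewrite big_geq.
  rewrite big_ltn//= big_nat big1 ?addr0// => n /andP[n2 _].
  by rewrite gtn_eqF.
have : (0 : R) <= N.+1%:R^-1 by rewrite invr_ge0.
by move: (N.+1%:R^-1) (\sum_(1 <= n < N.+1) _) => y z; lra.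
Qed.

(** Summing over all cuttings, instead of fixing one, gives a subprobability at each length that
    still dominates the product of block weights along any particular cutting. *)
Let Q s : R := cutweight r s.

Let Q_ge0 s : 0 <= Q s. Proof. exact: cutweight_ge0. Qed.

Let Q_gt0 s : 0 < Q s.
Proof. by apply: cutweight_gt0 => // x; apply: lt_le_trans (r_letter x); rewrite divr_gt0. Qed.

Let Q_le1 s : Q s <= 1.
Proof.
rewrite -lee_fin; apply: le_trans (mass_cutweight r0 mass_r (size s)).
apply: esum_ge; exists [set s]; last by rewrite fsbig_set1.
by split => // _ ->.
Qed.

Let nlnQ_le x (u v : seq A) : 0 < x -> x * Q u <= Q v -> - ln (Q v) <= - ln x - ln (Q u).
Proof.
move=> x0 xQ; rewrite -opprD lerN2 -lnM ?posrE//.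
by rewrite ler_ln ?posrE ?mulr_gt0.
Qed.

(** The slack [K] makes this set subinvariant: dropping the first letter does not lower the
    probability and changes the exponent only by [c]. *)
Let E c := \bigcup_(K : nat) lim_sup_set (fun n =>
  [set w : pathsp A | expR (- (n%:R * c) - K%:R) <= pr P (word n w)]).

Let mE c : measurable (E c).
Proof.
apply: bigcupT_measurable => K; apply: bigcapT_measurable => m.
apply: bigcup_measurable => n _.
exact: (measurable_word_preimage cA n [set s | expR (- (n%:R * c) - K%:R) <= pr P s]).
Qed.

Let E_subinvariant c : E c `<=` pshift @^-1` E c.
Proof.
move=> w [K _ wK]; exists (K + Num.Def.archi_bound `|c|)%N => // m _.
have [[|n] //= mn] := wK m.+1 I.
rewrite wordS -cat1s => /le_trans/(_ (pr_catr sP _ _)) le.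
exists n => //=; apply: le_trans le; rewrite ler_expR -natr1 natrD.
have := archi_boundP (normr_ge0 c); have := ler_norm c; lra.
Qed.

(* For 0 <= c below the entropy rate, P (E c) = 1 would let one code almost all of a long word by
   blocks at rate about c. *)
Lemma smb_lower_ge0 (L c : R) : (forall n, ((n%:R * L)%:E <= block_entropy P n)%E) ->
  0 <= c -> c < L ->
  {ae P, forall w, forall K : nat, exists m, forall n, (m <= n)%N ->
    pr P (word n w) < expR (- (n%:R * c) - K%:R)}.
Proof.
move=> HL c0 cL.
have [PE|PE] := ergodic_subinvariant measurable_pshift sP eP (mE c) (@E_subinvariant c).
  exists (E c); split => // w /= nw; apply: contrapT => nE; apply: nw => K.
  apply: contrapT => nK; apply: nE; exists K => // m _.
  apply: contrapT => nm; apply: nK; exists m => n mn.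
  by rewrite ltNge; apply/negP => le; apply: nm; exists n.
(* The gap [L - c] is split in three: one [e] raises the rate to [c'], one is the error of the
   packing, and the last one yields the contradiction. *)
exfalso; pose e := (L - c) / 3.
have e0 : 0 < e by rewrite divr_gt0// subr_gt0.
pose c' := c + e.
have c'0 : 0 <= c' by rewrite addr_ge0// ltW.
pose b w := - ln (nu (w (Posz 1)) / 2).
have nu2 x : 0 < nu x / 2 by rewrite divr_gt0.
have b0 (w : pathsp A) : 0 <= b w.
  by rewrite oppr_ge0 ln_le0// ler_pdivrMr// mul1r (le_trans (nu_le1 _))// ler1n.
have mb : measurable_fun setT b.
  exact: (measurable_fun_word cA 1 (fun s => - ln (nu (head point s) / 2))).
have [C hC] : exists C : R, forall N, exists B : pathsp A -> R,
  [/\ measurable_fun setT B, forall w, 0 <= B w,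
     forall w, - ln (Q (word N w)) <= N%:R * c' + B w &
     (\int[P]_w (B w)%:E <= (N%:R * e + C)%:E)%E].
  apply: (packing measurable_pshift sP (phi := fun N w => - ln (Q (word N w)))
    (good := fun n => [set w | expR (- (n%:R * c')) <= r (word n w)]) mb b0) => //.
  - have ln2 : 0 <= ln 2 :> R by rewrite ln_ge0// ler1n.
    rewrite (eq_integral (fun w => (- ln (nu (w (Posz 1))))%:E + cst (ln 2)%:E w)%E); last first.
      by move=> w _; rewrite /b ln_div ?posrE// opprB addrC EFinD EFinN.
    rewrite ge0_integralD//; last 2 first.
      + by move=> w _; rewrite lee_fin oppr_ge0 ln_le0// nu_le1.
      + exact: (measurable_fun_word cA 1 (fun s => (- ln (nu (head point s)))%:E)).
    by rewrite integral_cst// [X in (_ + _ * X)%E](probability_setT P) mule1 lte_add_pinfty// ltry.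
  - by move=> w; rewrite /word /= /Q cutweight_nil ln1 oppr0.
  (* A single letter costs at most [b]; adding [c'] keeps the bound because [0 <= c]. *)
  - move=> N w; rewrite wordS.
    have := @cutweight_cat _ _ _ r0 [:: w (Posz 1)] (word N (pshift w)) isT.
    move=> /(le_trans (ler_wpM2r (Q_ge0 _) (r_letter _)))/(nlnQ_le (nu2 _)) /=.
    by move/le_trans; apply; rewrite lerD2r /b lerDr.
  - move=> n; exact: (measurable_word_preimage cA n [set s | expR (- (n%:R * c')) <= r s]).
  - move=> n N w /= rn /andP[n0 nN].
    rewrite -{1}(subnKC nN) wordD.
    have := @cutweight_cat _ _ _ r0 (word n w) (word (N - n) (iter n pshift w)).
    rewrite -size_eq0 size_word -lt0n => /(_ n0).
    move=> /(le_trans (ler_wpM2r (Q_ge0 _) rn))/(nlnQ_le (expR_gt0 _)).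
    by rewrite expRK opprK.
  (* Along the infinitely many [n] given by [E c], the margin [n%:R * e] eventually absorbs the
     slack [K] and the factor [2 * (n * n.+1)] of the length prior. *)
  - apply: filterS (ae_prob1 (mE c) PE) => w [K _ wK].
    have [m hm] := expR_ge_quadratic e0 (mulr_ge0 (ler0n R 2) (expR_ge0 K%:R)).
    have [n /= mn prn] := wK m.+1 I.
    have n0 : (0 < n)%N by exact: leq_ltn_trans mn.
    exists n => //=.
    have := @r_block (word n w); rewrite -size_eq0 size_word -lt0n => /(_ n0).
    apply: le_trans; rewrite ler_pdivlMr ?mulr_gt0 ?ltr0n//.
    apply: le_trans prn.
    have le : 2 * (n%:R * n.+1%:R) <= expR (n%:R * e - K%:R).
      rewrite expRB ler_pdivlMr ?expR_gt0//.
      by apply: le_trans (hm n (ltnW mn)); rewrite mulrAC.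
    apply: (le_trans (ler_wpM2l (expR_ge0 _) le)).
    by rewrite -expRD ler_expR /c' mulrDr; lra.
(* Gibbs' inequality bounds [N * L] by the mean length of the packing code [Q], which is at most
   [N * (c' + e) + C]. *)
have key N : N%:R * e <= C.
  have [B [mB B0 QB intB]] := hC N.
  suff : ((N%:R * L)%:E <= (N%:R * c' + (N%:R * e + C))%:E)%E.
    by rewrite lee_fin /c' /e; lra.
  apply: (le_trans (HL N)).
  apply: (@le_trans _ _ (\int[P]_w (- ln (Q (word N w)))%:E)%E).
    apply: block_entropy_le => //.
    - by move=> s; rewrite Q_ge0 Q_le1.
    - exact: mass_cutweight.
  apply: (@le_trans _ _ (\int[P]_w (cst (N%:R * c')%:E w + (B w)%:E))%E).
    apply: ge0_le_integral => //.
    - by move=> w _; rewrite lee_fin oppr_ge0 ln_le0// Q_le1.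
    - exact: (measurable_fun_word cA N (fun s => (- ln (Q s))%:E)).
    - by apply: emeasurable_funD; [exact: measurable_cst|exact/measurable_EFinP].
    - by move=> w _; rewrite -EFinD lee_fin.
  rewrite ge0_integralD//; last 3 first.
    - by move=> w _; rewrite lee_fin mulr_ge0.
    - by move=> w _; rewrite lee_fin.
    - exact/measurable_EFinP.
  by rewrite integral_cst// [X in (_ * X + _)%E](probability_setT P) mule1 [leRHS]EFinD leeD2l.
have C0 : 0 <= C by have := key 0%N; rewrite mul0r.
have /archi_boundP : 0 <= C / e by rewrite divr_ge0// ltW.
by rewrite ltr_pdivrMr// ltNge key.
Qed.

Lemma smb_lower (L c : R) : (forall n, ((n%:R * L)%:E <= block_entropy P n)%E) -> c < L ->
  {ae P, forall w, exists m, forall n, (m <= n)%N -> pr P (word n w) < expR (- (n%:R * c))}.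
Proof.
move=> HL cL; have [c0|c0] := leP 0 c.
  apply: filterS (smb_lower_ge0 HL c0 cL) => w /(_ 0%N).
  by under eq_exists do under eq_forall do rewrite subr0.
(* For negative [c] the bound exceeds 1 as soon as [n] is positive. *)
apply: nearW => w; exists 1%N => n n0.
have /andP[_ /le_lt_trans] := pr01 P (word n w); apply.
by rewrite -[ltLHS]expR0 ltr_expR oppr_gt0 nmulr_llt0 ?ltr0n.
Qed.

(** [barron] is combined with [smb_lower] at the midpoint [c1] of [c] and [L]; the factor [n * n.+1]
    is absorbed by [expR (n%:R * (c1 - c))]. *)
Lemma code_length_lower (L c : R) (q : seq A -> R) :
  (forall n, ((n%:R * L)%:E <= block_entropy P n)%E) -> c < L ->
  (forall s, 0 <= q s) -> (forall n, mass (fun s => (q s)%:E) n <= 1)%E ->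
  {ae P, forall w, exists m, forall n, (m <= n)%N -> q (word n w) <= expR (- (n%:R * c))}.
Proof.
move=> HL cL q0 q1; pose c1 := (c + L) / 2.
have cc1 : 0 < c1 - c by rewrite /c1; lra.
have c1L : c1 < L by rewrite /c1; lra.
have [m3 hm3] := expR_ge_quadratic cc1 ler01.
apply: filterS2 (barron q0 q1) (smb_lower HL c1L) => w [m1 h1] [m2 h2].
exists (maxn m1 (maxn m2 m3)) => n; rewrite !geq_max => /and3P[n1 n2 n3].
apply: (le_trans (h1 _ n1)).
apply: (@le_trans _ _ (expR (n%:R * (c1 - c)) * expR (- (n%:R * c1)))).
  apply: ler_pM; [exact: mulr_ge0|exact: pr_ge0| |exact/ltW/h2].
  by rewrite -[leLHS]mul1r hm3.
by rewrite -expRD ler_expR; lra.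
Qed.

End smb.

(** * Cells and densities *)

Lemma esum_exchange (R : realType) (I J : choiceType) (D : set I) (D' : set J)
    (a : I -> J -> \bar R) : (forall i j, 0 <= a i j)%E ->
  \esum_(i in D) \esum_(j in D') a i j = \esum_(j in D') \esum_(i in D) a i j.
Proof.
move=> a0; rewrite !esum_esum//.
rewrite (reindex_esum (D' `*`` (fun=> D)) _ (fun x => (x.2, x.1)))//; split=> //=.
- by move=> [i j] [/=].
- by move=> [i1 i2] [j1 j2] /= _ _ [] -> ->.
- by move=> [i1 i2] [Pi1 Qi2] /=; exists (i2, i1).
Qed.

Lemma esum_subset (R : realType) (I : choiceType) (D D' : set I) (a : I -> \bar R) :
  D `<=` D' -> (\esum_(i in D) a i <= \esum_(i in D') a i)%E.
Proof.
move=> DD'; apply: le_ereal_sup => _ [F [finF FD] <-]; exists F => //.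
by split => //; exact: subset_trans DD'.
Qed.

Section cells.
Context {R : realType} {X : pointedType} (mu : X -> R).
Hypothesis mu0 : forall x, 0 < mu x.
Hypothesis mu1 : (\esum_(x in [set: X]) (mu x)%:E)%E = 1%E.

(** Stated for an arbitrary labelling; [mucell mu c l] is [cellmass mu (c l)] by conversion. *)
Definition cellmass (B : Type) (f : X -> B) (x : X) : R :=
  fine (\esum_(y in [set y | f y = f x]) (mu y)%:E)%E.

Lemma cellmassE (B : Type) (f : X -> B) x :
  (cellmass f x)%:E = (\esum_(y in [set y | f y = f x]) (mu y)%:E)%E.
Proof.
have p0 : (0 <= \esum_(y in [set y | f y = f x]) (mu y)%:E)%E.
  by apply: esum_ge0 => y _; rewrite lee_fin ltW.
rewrite fineK// ge0_fin_numE//.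
by apply: (@le_lt_trans _ _ 1%E); rewrite ?ltry// -mu1; exact: esum_subset.
Qed.

Lemma cellmass_le1 (B : Type) (f : X -> B) x : cellmass f x <= 1.
Proof. by rewrite -lee_fin cellmassE -mu1; exact: esum_subset. Qed.

Lemma mu_le_cellmass (B : Type) (f : X -> B) x : mu x <= cellmass f x.
Proof.
rewrite -lee_fin cellmassE; apply: esum_ge.
by exists [set x]; [split => // y ->|rewrite fsbig_set1].
Qed.

Lemma cellmass_gt0 (B : Type) (f : X -> B) x : 0 < cellmass f x.
Proof. exact: lt_le_trans (mu_le_cellmass f x). Qed.

(** On a nonempty cell this is the conditional law of [mu], of total mass 1. *)
Lemma esum_cell_density (B : Type) (f : X -> B) (j : B) :
  (\esum_(x in [set x | f x = j]) (mu x / cellmass f x)%:E <= 1)%E.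
Proof.
have [[x0 <-]|nj] := pselect (exists x, f x = j); last first.
  by rewrite esum1// => x /= xj; case: nj; exists x.
rewrite (eq_esum (b := fun x => ((cellmass f x0)^-1%:E * (mu x)%:E)%E)); last first.
  by move=> x /= fx; rewrite mulrC EFinM /cellmass fx.
rewrite esumZl; last 2 first.
- by rewrite invr_ge0 ltW// cellmass_gt0.
- by move=> x; rewrite lee_fin ltW.
by rewrite -cellmassE -EFinM mulVf// gt_eqF// cellmass_gt0.
Qed.

(* Only the finitely many points carrying all but e of mu have to be separated from x. *)
Lemma cellmass_cvg (B : nat -> Type) (f : forall l, X -> B l) (x : X) :
  (forall l y, f l.+1 y = f l.+1 x -> f l y = f l x) ->
  (forall y, y <> x -> exists l, f l y <> f l x) ->
  (fun l => cellmass (f l) x) @ \oo --> mu x.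
Proof.
move=> fref fsep; apply/cvgrPdist_le => e e0.
have sepS l l' y : (l <= l')%N -> f l y <> f l x -> f l' y <> f l' x.
  elim: l' => [|l' IH]; first by rewrite leqn0 => /eqP ->.
  by rewrite leq_eqVlt => /predU1P[-> //|ll'] ny /fref; exact: IH.
have : ((1 - e)%:E < \esum_(y in [set: X]) (mu y)%:E)%E.
  by rewrite mu1 lte_fin gtrBl.
move=> /ereal_sup_gt[_ [F [finF _] <-]] Fe.
(* [lx y] is a level at which [y] is separated from [x]; from the maximum over [F] on, the cell of
   [x] meets [F] at most in [x]. *)
pose lx y : nat := if pselect (y <> x) is left h then projT1 (cid (fsep y h)) else 0%N.
have lxP y : y <> x -> f (lx y) y <> f (lx y) x.
  by rewrite /lx; case: pselect => // h _; exact: (projT2 (cid (fsep y h))).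
exists (\max_(y <- finmap.enum_fset (fset_set F)) lx y)%N => // l /= Fl.
have Fsep y : F y -> y <> x -> f l y <> f l x.
  move=> Fy /lxP; apply: sepS; apply: leq_trans Fl.
  by apply: leq_bigmax_seq => //; rewrite in_fset_set// inE.
rewrite ler0_norm ?subr_le0 ?mu_le_cellmass// opprB lerBlDl.
pose C := [set y | f l y = f l x].
(* As [C] and [F] share at most [x], their masses add up to at most [1 + mu x]; since [F] has mass
   above [1 - e], [C] has mass below [mu x + e]. *)
have CF : (\esum_(y in C) (mu y)%:E + \esum_(y in F) (mu y)%:E <= (1 + mu x)%:E)%E.
  rewrite [in X in (_ + X)%E](esumID C); last by move=> y _; rewrite lee_fin ltW.
  rewrite addeCA [(1 + mu x)]addrC EFinD leeD//.
    rewrite -[leRHS](esum_set1 (a := EFin \o mu)); last by rewrite /= lee_fin ltW.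
    apply: esum_subset => y [Fy /= Cy]; apply: contrapT => yx.
    exact: (Fsep _ Fy yx).
  rewrite -mu1 (esumID C [set: X]); last by move=> y _; rewrite lee_fin ltW.
  by rewrite setTI leeD2l//; apply: esum_subset => y [].
rewrite -lee_fin cellmassE -/C.
have FE : (\esum_(y in F) (mu y)%:E = \sum_(y \in F) (mu y)%:E)%E.
  by rewrite esum_fset// => y _; rewrite lee_fin ltW.
move: CF Fe; rewrite -FE -cellmassE.
have Ffin : (\esum_(y in F) (mu y)%:E)%E \is a fin_num.
  rewrite ge0_fin_numE; last by apply: esum_ge0 => y _; rewrite lee_fin ltW.
  by apply: (@le_lt_trans _ _ 1%E); rewrite ?ltry// -mu1; exact: esum_subset.
rewrite -(fineK Ffin) -EFinD lee_fin lte_fin lee_fin; lra.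
Qed.

End cells.

(* The sets that do not distinguish x from y form a sigma-algebra. *)
Lemma generating_cells_separate (X : Type) (B : nat -> Type) (c : forall l, X -> B l) :
  <<s [set E | exists l (j : B l), E = c l @^-1` [set j]] >> = [set: set X] ->
  forall x y, x <> y -> exists l, c l x <> c l y.
Proof.
move=> gen x y xy; apply: contrapT => nsep.
have same l : c l x = c l y by apply: contrapT => ne; apply: nsep; exists l.
pose S := [set E : set X | E x <-> E y].
have sS : sigma_algebra setT S.
  split => [//|E Exy|F Fxy]; rewrite /S /=.
    by split => -[_ nE]; split => // /Exy.
  by split => -[n _ Fn]; exists n => //; apply/Fxy.
have : S [set x].
  have : <<s [set E | exists l (j : B l), E = c l @^-1` [set j]] >> [set x].
    by rewrite gen.
  by apply: (smallest_sub sS) => _ [l [j ->]]; rewrite /S /= same.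
by rewrite /S /= => -[/(_ erefl)] /esym.
Qed.

(** * Coding by cells and the mixture over levels *)

Lemma mass_rcons (R : realType) (A : pointedType) n (f : seq A -> \bar R) :
  (forall s, 0 <= f s)%E ->
  mass f n.+1 = mass (fun u => \esum_(x in [set: A]) f (rcons u x)) n.
Proof.
move=> f0; rewrite -addn1 mass_cat//; congr mass; apply/funext => u.
by rewrite mass1; apply: eq_esum => x _; rewrite cats1.
Qed.

(** The one-letter extensions of [s] have disjoint cylinders inside that of [s]. *)
Lemma sum_pr_rcons (R : realType) k (Q : probability (pathsp 'I_k.+1) R) s :
  \sum_(j < k.+1) pr Q (rcons s j) <= pr Q s.
Proof.
rewrite -lee_fin -sumEFin (prE Q erefl).
rewrite (eq_bigr (fun j => Q (word (size s).+1 @^-1` [set rcons s j]))); last first.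
  by move=> j _; rewrite (prE Q (size_rcons s j)).
rewrite -measure_bigsetU_ord; last 2 first.
- by move=> j; exact: measurable_word.
- by move=> i j _ _ [w [/= -> /rcons_inj[]]].
rewrite le_measure ?inE//.
- refine (@big_ind (set (pathsp 'I_k.+1)) measurable set0 setU _ _ _ _ _ _ _).
  + exact: measurable0.
  + by move=> ? ?; exact: measurableU.
  + by move=> j _; exact: measurable_word.
- exact: measurable_word.
apply: (@big_ind (set (pathsp 'I_k.+1)) (fun S => S `<=` _)) => [|S T Ss Ts|j _ w /=].
- exact: sub0set.
- by rewrite subUset.
rewrite -[(size s).+1]addn1 wordD -cats1 => /eqP.
by rewrite eqseq_cat ?size_word// => /andP[/eqP].
Qed.

Section coding.
Context {R : realType} {X : pointedType} (mu : X -> R).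
Hypothesis mu0 : forall x, 0 < mu x.
Hypothesis mu1 : (\esum_(x in [set: X]) (mu x)%:E)%E = 1%E.

(** Induction on the length, summing over the last letter: within one cell the conditional densities
    sum to at most 1, and the sum over cells is controlled by the hypothesis on [rho]. *)
Lemma mass_refine k (f : X -> 'I_k.+1) (rho : seq 'I_k.+1 -> R) n :
  (forall a, 0 <= rho a) -> (forall a, \sum_j rho (rcons a j) <= rho a) ->
  (mass (fun s => (rho (map f s) * \prod_(x <- s) (mu x / cellmass mu f x))%:E) n
    <= (rho [::])%:E)%E.
Proof.
move=> rho0 rhoS.
have nu0 x : 0 <= mu x / cellmass mu f x by rewrite divr_ge0 ?ltW// cellmass_gt0.
have prod0 s : 0 <= \prod_(x <- s) (mu x / cellmass mu f x) by rewrite prodr_ge0.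
elim: n => [|n IH]; first by rewrite mass0 ?lee_fin ?mulr_ge0// big_nil mulr1.
rewrite mass_rcons; last by move=> s; rewrite lee_fin mulr_ge0.
apply: le_trans IH; apply: mass_le => u _.
set p := \prod_(x <- u) _.
have p0 : 0 <= p by exact: prod0.
apply: (@le_trans _ _ (p%:E * \esum_(x in [set: X])
    (rho (rcons (map f u) (f x)) * (mu x / cellmass mu f x))%:E)%E).
  rewrite -esumZl//; last by move=> x; rewrite lee_fin mulr_ge0.
  apply: le_esum => x _; rewrite -EFinM lee_fin map_rcons -[rcons u x]cats1 big_cat big_seq1 /=.
  by rewrite mulrCA.
rewrite mulrC EFinM lee_wpmul2l ?lee_fin//.
apply: (@le_trans _ _ (\esum_(x in [set: X]) \sum_(j < k.+1)
    (if f x == j then rho (rcons (map f u) j) * (mu x / cellmass mu f x) else 0)%:E)%E).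
  apply: le_esum => x _; rewrite (bigD1 (f x))//= eqxx leeDl// sume_ge0// => j _.
  by rewrite lee_fin; case: ifP => // _; rewrite mulr_ge0.
rewrite esum_sum; last by move=> x j _ _; rewrite lee_fin; case: ifP => // _; rewrite mulr_ge0.
apply: (@le_trans _ _ (\sum_(j < k.+1) (rho (rcons (map f u) j))%:E)%E); last first.
  by rewrite sumEFin lee_fin.
apply: lee_sum => j _.
apply: (@le_trans _ _ (\esum_(x in [set x | f x = j])
    ((rho (rcons (map f u) j))%:E * (mu x / cellmass mu f x)%:E))%E).
  rewrite [leRHS]esum_mkcond; apply: le_esum => x _.
  case: eqP => [fx|]; first by rewrite mem_set.
  by move=> _; case: ifP => // _; rewrite -EFinM lee_fin mulr_ge0.
rewrite esumZl// -[leRHS]mule1 lee_wpmul2l ?lee_fin//.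
exact: esum_cell_density.
Qed.

Context (k : nat -> nat) (c : forall l, X -> 'I_(k l).+1)
  (Rm : forall l, probability (pathsp 'I_(k l).+1) R).

(** The word of cells is coded by [Rm l] and each letter within its cell by the conditional law of
    [mu]; this is [NPDl] times the product of the [mu x]. *)
Definition levelprob l (s : seq X) : R :=
  pr (Rm l) (map (c l) s) * \prod_(x <- s) (mu x / cellmass mu (c l) x).

Lemma levelprob_ge0 l s : 0 <= levelprob l s.
Proof.
rewrite mulr_ge0 ?pr_ge0// prodr_ge0// => x _.
by rewrite divr_ge0 ?ltW// cellmass_gt0.
Qed.

Lemma mass_levelprob l n : (mass (fun s => (levelprob l s)%:E) n <= 1)%E.
Proof.
rewrite -[leRHS](congr1 EFin (pr_nil (Rm l))).
apply: (@mass_refine (k l) (c l) (pr (Rm l))); first exact: pr_ge0.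
by move=> a; exact: sum_pr_rcons.
Qed.

Lemma wgt_gt0 l : 0 < wgt l :> R.
Proof. by rewrite /wgt subr_gt0 ltf_pV2 ?posrE// ltr_nat. Qed.

Lemma esum_wgt : (\esum_(l in [set: nat]) (wgt l : R)%:E <= 1)%E.
Proof.
rewrite -nneseries_esumT; last by move=> l; rewrite lee_fin ltW// wgt_gt0.
apply: lime_le.
  by apply: is_cvg_nneseries => l _; rewrite lee_fin ltW// wgt_gt0.
apply: nearW => N /=; rewrite sumEFin lee_fin.
have -> : \sum_(0 <= l < N) wgt l = 1 - N.+1%:R^-1 :> R.
  by rewrite -telescope_inv big_add1.
by rewrite lerBlDr lerDl invr_ge0.
Qed.

Let mixe s := (\esum_(l in [set: nat]) (wgt l * levelprob l s)%:E)%E.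

Let term_ge0 l s : (0 <= (wgt l * levelprob l s)%:E)%E.
Proof. by rewrite lee_fin mulr_ge0 ?levelprob_ge0// ltW// wgt_gt0. Qed.

Let mass_mixe n : (mass mixe n <= 1)%E.
Proof.
rewrite /mass /mixe esum_exchange; last by move=> s l; exact: term_ge0.
apply: le_trans esum_wgt; apply: le_esum => l _.
rewrite -/(mass (fun s => (wgt l * levelprob l s)%:E) n) massZl; last 2 first.
- by rewrite ltW// wgt_gt0.
- exact: levelprob_ge0.
rewrite -[leRHS]mule1 lee_wpmul2l ?mass_levelprob// lee_fin ltW//; exact: wgt_gt0.
Qed.

Let mixe_ge0 s : (0 <= mixe s)%E. Proof. exact: esum_ge0. Qed.

Let mixe_fin s : mixe s \is a fin_num.
Proof.
rewrite ge0_fin_numE//; apply: (@le_lt_trans _ _ 1%E); last by rewrite ltry.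
apply: le_trans (mass_mixe (size s)); apply: esum_ge.
by exists [set s]; [split => // _ ->|rewrite fsbig_set1].
Qed.

(* The subprobability NPD(s) * \prod mu(s_i) on words of each length. *)
Definition mixprob s : R := fine (mixe s).

Lemma mixprob_ge0 s : 0 <= mixprob s. Proof. by rewrite fine_ge0. Qed.

Lemma mass_mixprob n : (mass (fun s => (mixprob s)%:E) n <= 1)%E.
Proof.
by apply: le_trans (mass_mixe n); apply: mass_le => s _; rewrite fineK.
Qed.

Lemma levelprob_le_mixprob l s : wgt l * levelprob l s <= mixprob s.
Proof.
rewrite -lee_fin fineK//; apply: esum_ge.
by exists [set l]; [split|rewrite fsbig_set1].
Qed.

Lemma NPD_E n (x : n.-tuple X) :
  NPD mu c Rm x = (mixprob x / \prod_(y <- x) mu y)%:E.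
Proof.
have p0 : 0 < \prod_(y <- x) mu y by rewrite prodr_gt0.
rewrite mulrC EFinM /mixprob fineK// /mixe -esumZl ?invr_ge0 ?ltW//.
apply: eq_esum => l _; rewrite -EFinM /NPDl; congr EFin.
rewrite cyltE /levelprob /pr size_map size_tuple /=.
rewrite -(big_tuple _ _ x xpredT (mucell mu c l)).
rewrite prodf_div [RHS]mulrCA; congr (_ * _); rewrite [RHS]mulrCA; congr (_ * _).
by rewrite mulKf ?gt_eqF.
Qed.

Lemma code_lengthE n (w : pathsp X) :
  (- elog (NPD mu c Rm (blk n w)) - (\sum_(i < n) ln (mu (w (Posz i.+1))))%:E =
   - elog (mixprob (word n w))%:E)%E.
Proof.
rewrite NPD_E tval_blk.
have -> : \sum_(i < n) ln (mu (w (Posz i.+1))) = ln (\prod_(y <- word n w) mu y).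
  elim: n => [|n IH]; first by rewrite big_ord0 big_nil ln1.
  rewrite big_ord_recr -[n.+1 in RHS]addn1 wordD big_cat /= IH lnM ?posrE ?prodr_gt0//.
  by rewrite word1 big_seq1 iter_pshift; congr (_ + ln (mu (w _))); lia.
have p0 : 0 < \prod_(y <- word n w) mu y by rewrite prodr_gt0.
(* If [mixprob] vanishes, both sides are [+oo], as [elog] is [-oo] at 0. *)
rewrite /elog pmulr_lle0 ?invr_gt0//; case: leP => // q0.
by rewrite ln_div ?posrE// -!EFinN -EFinD opprB addrAC subrr sub0r.
Qed.

End coding.

(** * Quantized processes and the upper bound *)

Section factor.
Context {R : realType} {X B : pointedType} (cX : countable [set: X]) (cB : countable [set: B]).
Context (f : X -> B) (P : probability (pathsp X) R).

Definition relabel (w : pathsp X) : pathsp B := f \o w.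

Lemma measurable_relabel : measurable_fun setT relabel.
Proof.
apply: (@measurability _ _ (pathsp X) (pathsp B) _ _ (@cylinders B)) => //.
move=> _ [_ [i [b ->]] <-]; rewrite setTI.
exact: (measurable_preimage_discrete (Y := fun w : pathsp X => w i) cX
  (measurable_coord i) [set x | f x = b]).
Qed.

Lemma word_relabel n w : word n (relabel w) = map f (word n w).
Proof. by rewrite /word -map_comp. Qed.

Lemma factor_process : exists Q : probability (pathsp B) R,
  forall E, Q E = P (relabel @^-1` E).
Proof. by exists (distribution P (mfun_Sub (mem_set measurable_relabel))). Qed.

Context (Q : probability (pathsp B) R) (QE : forall E, Q E = P (relabel @^-1` E)).

Let mrel E : measurable E -> measurable (relabel @^-1` E).
Proof. by move=> mE; rewrite -[X in measurable X]setTI; exact: measurable_relabel. Qed.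

Lemma stationary_factor : stationary P -> stationary Q.
Proof. by move=> sP E mE; rewrite !QE -[RHS](sP _ (mrel mE)). Qed.

Lemma ergodic_factor : ergodic P -> ergodic Q.
Proof.
move=> eP E mE TE; rewrite QE; apply: (eP _ (mrel mE)).
by rewrite -[in RHS]TE.
Qed.

Lemma ae_factor (G : pathsp B -> Prop) :
  {ae Q, forall v, G v} -> {ae P, forall w, G (relabel w)}.
Proof.
move=> [N [mN QN GN]]; exists (relabel @^-1` N); split; first exact: mrel.
  by rewrite -QE.
by move=> w /GN.
Qed.

Lemma pr_le_factor s : pr P s <= pr Q (map f s).
Proof.
rewrite -lee_fin (prE P erefl) (prE Q (size_map f s)) QE le_measure ?inE//.
- exact: measurable_word.
- by apply: mrel; exact: measurable_word.
- by move=> w /= ws; rewrite word_relabel ws.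
Qed.

Lemma integral_factor (g : pathsp B -> \bar R) : measurable_fun setT g ->
  (forall v, 0 <= g v)%E -> (\int[Q]_v g v = \int[P]_w g (relabel w))%E.
Proof.
move=> mg g0.
have := ge0_integral_pushforward measurable_relabel P measurableT mg (fun v _ => g0 v).
rewrite preimage_setT => <-; apply: eq_measure_integral; first exact: measurable_relabel.
by move=> ? E mE _; exact: QE.
Qed.

(** A word is at most as probable as its word of cells, so the integrands compare on words of
    positive probability. *)
Lemma block_entropy_factor n : (block_entropy Q n <= block_entropy P n)%E.
Proof.
rewrite !block_entropyE// integral_factor; last 2 first.
- exact: measurable_nln_pr.
- by move=> v; rewrite lee_fin nln_pr_ge0.
under eq_integral do rewrite word_relabel.
rewrite (integral_word cX P n (g := fun s => - ln (pr Q (map f s)))); last first.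
  by move=> s; exact: nln_pr_ge0.
rewrite (integral_word cX P n (g := fun s => - ln (pr P s))); last exact: nln_pr_ge0.
apply: mass_le => s _; rewrite lee_fin.
(* Null words are set apart: there [ln 0 = 0] would spoil the comparison of logarithms, but the
   weight is 0. *)
have := pr_ge0 P s; rewrite le_eqVlt => /predU1P[<-|p0]; first by rewrite !mulr0.
apply: ler_wpM2r; first exact: ltW.
have q0 := lt_le_trans p0 (pr_le_factor s).
by rewrite lerN2 ler_ln ?posrE// pr_le_factor.
Qed.

End factor.

Section upper.
Context {R : realType} {X : pointedType} (cX : countable [set: X]).
Context (mu : X -> R) (mu0 : forall x, 0 < mu x).
Hypothesis mu1 : (\esum_(x in [set: X]) (mu x)%:E)%E = 1%E.
Context (P : probability (pathsp X) R) (sP : stationary P) (eP : ergodic P).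
Hypothesis imu : (\int[P]_w (- ln (mu (w (Posz 1))))%:E < +oo)%E.

Lemma cross_entropy1E :
  cross_entropy1 mu P = (\int[P]_w (- ln (mu (w (Posz 1))))%:E)%E.
Proof.
rewrite (integral_word cX P 1 (g := fun s => - ln (mu (head point s)))); last first.
  move=> s; rewrite oppr_ge0 ln_le0//; apply: le_trans (cellmass_le1 mu0 mu1 id (head point s)).
  exact: mu_le_cellmass.
rewrite mass1; apply: eq_esum => x _ /=; congr EFin.
rewrite mulrC mulNr; congr (- (ln _ * _)); rewrite /pr; congr (fine (P _)).
by apply/seteqP; split => w; rewrite /= word1; [move=> ->|move=> []].
Qed.

(** The code length of the first letter given its cell, under the conditional law of [mu] on that
    cell. *)
Definition excess (B : Type) (f : X -> B) (w : pathsp X) : R :=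
  ln (cellmass mu f (w (Posz 1))) - ln (mu (w (Posz 1))).

Lemma excess_ge0 (B : Type) (f : X -> B) w : 0 <= excess f w.
Proof. by rewrite subr_ge0 ler_ln ?posrE ?cellmass_gt0// mu_le_cellmass. Qed.

Lemma excess_le (B : Type) (f : X -> B) w : excess f w <= - ln (mu (w (Posz 1))).
Proof. by rewrite gerDr ln_le0// cellmass_le1. Qed.

Lemma measurable_excess (B : Type) (f : X -> B) : measurable_fun setT (excess f).
Proof.
exact: (measurable_fun_word cX 1
  (fun s => ln (cellmass mu f (head point s)) - ln (mu (head point s)))).
Qed.

Lemma integral_excess_fin (B : Type) (f : X -> B) :
  (\int[P]_w (excess f w)%:E)%E \is a fin_num.
Proof.
rewrite ge0_fin_numE; last by apply: integral_ge0 => w _; rewrite lee_fin excess_ge0.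
apply: le_lt_trans imu; apply: ge0_le_integral => //.
- by move=> w _; rewrite lee_fin excess_ge0.
- apply/measurable_EFinP; exact: (measurable_excess _).
- exact: (measurable_fun_word cX 1 (fun s => (- ln (mu (head point s)))%:E)).
- by move=> w _; rewrite lee_fin excess_le.
Qed.

Lemma integral_excess_cvg0 (B : nat -> Type) (c : forall l, X -> B l) :
  (forall x, (fun l => cellmass mu (c l) x) @ \oo --> mu x) ->
  (\int[P]_w (excess (c l) w)%:E)%E @[l --> \oo] --> 0%E.
Proof.
move=> cvgc.
have mln : measurable_fun setT (fun w : pathsp X => (- ln (mu (w (Posz 1))))%:E).
  exact: (measurable_fun_word cX 1 (fun s => (- ln (mu (head point s)))%:E)).
have := @dominated_cvg _ _ _ P setT measurableT
  (fun l w => (excess (c l) w)%:E) (cst 0%E) (fun w : pathsp X => (- ln (mu (w (Posz 1))))%:E).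
rewrite integral0; apply => //.
- by move=> l; apply/measurable_EFinP; exact: (measurable_excess _).
- move=> w _; apply/fine_cvgP; split; first exact: nearW.
  rewrite -(subrr (ln (mu (w (Posz 1))))); apply: cvgB; last exact: cvg_cst.
  by apply: continuous_cvg (cvgc _); apply: continuous_ln.
- apply/integrableP; split => //.
  rewrite (eq_integral (fun w : pathsp X => (- ln (mu (w (Posz 1))))%:E))// => w _.
  by rewrite /= ger0_norm// (le_trans (excess_ge0 (c 0%N) w))// excess_le.
- by move=> l w _; rewrite /= lee_fin ger0_norm ?excess_ge0// excess_le.
Qed.

(** Turns the density factor of [levelprob] into a Birkhoff sum along the shift, ready for
    [ergodic_average_le]. *)
Lemma prod_density (B : Type) (f : X -> B) n w :
  \prod_(x <- word n w) (mu x / cellmass mu f x) =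
  expR (- \sum_(0 <= i < n) excess f (iter i pshift w)).
Proof.
elim: n => [|n IH]; first by rewrite !big_nil oppr0 expR0.
rewrite big_nat_recr// -addn1 wordD big_cat IH opprD expRD /=; congr (_ * _).
rewrite word1 big_seq1 /excess opprB expRB !lnK ?posrE ?cellmass_gt0//.
Qed.

Context (k : nat -> nat) (c : forall l, X -> 'I_(k l).+1)
  (Rm : forall l, probability (pathsp 'I_(k l).+1) R).
Hypothesis uR : forall l, universal (Rm l).

(** The tolerance [e] is shared by three errors: the universal code length of the cells, the
    Birkhoff sum of [excess], and the constant made of [K] and [wgt l]. The cell process has entropy
    rate [Ll <= L], since relabelling does not increase block entropies. *)
Lemma mixprob_lower (L : R) l (e : R) : 0 < e -> entropy_rate P = L%:E ->
  (block_entropy P 1 < +oo)%E ->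
  {ae P, forall w, exists m, forall n, (m <= n)%N ->
    expR (- (n%:R * (L + fine (\int[P]_w (excess (c l) w)%:E)%E + e))) <=
    mixprob mu c Rm (word n w)}.
Proof.
move=> e0 PL H1.
have e30 : 0 < e / 3 by rewrite divr_gt0.
have cI : countable [set: 'I_(k l).+1] by exact: countableP.
have [Q QE] := factor_process cX (c l) P.
have sQ := stationary_factor cX QE sP.
have eQ := ergodic_factor cX QE eP.
have QP n := block_entropy_factor cX cI QE n.
have [L' [PL' _ cvgP]] := entropy_rateP cX sP H1.
have [Ll [QL _ cvgQ]] := entropy_rateP cI sQ (le_lt_trans (QP 1%N) H1).
have LlL : Ll <= L.
  rewrite -lee_fin -PL PL'; apply: (lee_cvg_to cvgQ cvgP).
  by apply: nearW => n; rewrite lee_wpmul2l// lee_fin invr_ge0.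
have [+ _] := @uR l Q sQ eQ; rewrite QL => /(ae_factor cX QE).
have intE := fineK (integral_excess_fin (c l)).
set G := fine _ in intE *.
have := ergodic_average_le measurable_pshift sP eP (measurable_excess (c l))
  (excess_ge0 (c l)) _ e30.
move=> /(_ G); rewrite -intE lexx => /(_ erefl).
move=> bir uni; apply: filterS2 bir uni => w [K SK].
move=> /fine_cvgP[[m1 _ fin] /cvgrPdist_lt/(_ _ e30)[m2 _ lim]].
set a := (K%:R - ln (wgt l)) / (e / 3).
exists (maxn 1 (maxn m1 (maxn m2 (Num.Def.archi_bound `|a|)))) => n.
rewrite !geq_max => /and4P[n1 nm1 nm2 nm3].
have n0 : (0 : R) < n%:R by rewrite ltr0n.
have := lim n nm2; have := fin n nm1; rewrite /=.
have -> : Rm l (cylt (blk n (relabel (c l) w))) = (pr (Rm l) (map (c l) (word n w)))%:E.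
  by rewrite cyltE tval_blk word_relabel (prE (Rm l) (n := n))// size_map size_word.
(* A null probability would make the normalized code length [+oo], which convergence to a finite
   rate excludes for these [n]. *)
set p := pr _ _; rewrite /elog; case: (leP p 0) => p0.
  by rewrite /= gt0_muley// lte_fin invr_gt0.
move=> _; rewrite -EFinN -EFinM /= => limn.
have lnp : - ln p <= n%:R * (L + e / 3).
  rewrite -ler_pdivrMl//; move: limn; rewrite distrC => /ltW/(le_trans (ler_norm _)).
  by rewrite lerBlDr => /le_trans; apply; rewrite addrC lerD2r.
have w0 : 0 < wgt l :> R by exact: wgt_gt0.
apply: le_trans (levelprob_le_mixprob mu0 mu1 c Rm l (word n w)).
rewrite /levelprob prod_density -/p -[wgt l]lnK ?posrE// -[p]lnK ?posrE// -!expRD ler_expR.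
have an : K%:R - ln (wgt l) <= n%:R * (e / 3).
  rewrite -ler_pdivrMr// -/a (le_trans (ler_norm _))//.
  rewrite (le_trans (ltW (archi_boundP (normr_ge0 a))))//.
  by rewrite ler_nat.
have := SK n; move: lnp an; rewrite !mulrDr.
have : n%:R * e = n%:R * (e / 3) + n%:R * (e / 3) + n%:R * (e / 3) by lra.
lra.
Qed.

End upper.

(** * Convergence of the code length *)

Lemma code_length_cvg (R : realType) (q : nat -> R) (L : R) :
  (forall j : nat, exists m, forall n, (m <= n)%N ->
     expR (- (n%:R * (L + j.+1%:R^-1))) <= q n <= expR (- (n%:R * (L - j.+1%:R^-1)))) ->
  (fun n => (n%:R^-1)%:E * - elog (q n)%:E)%E @ \oo --> L%:E.
Proof.
move=> qL.
have main (j : nat) : \forall n \near \oo, 0 < q n /\ `|L - n%:R^-1 * - ln (q n)| <= j.+1%:R^-1.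
  have [m hm] := qL j; exists m.+1 => // n /= mn.
  have /andP[lo hi] := hm n (ltnW mn).
  have q0 : 0 < q n by apply: lt_le_trans lo; exact: expR_gt0.
  have n0 : (0 : R) < n%:R by rewrite ltr0n (leq_ltn_trans _ mn).
  split => //; rewrite ler_distlC.
  rewrite ler_pdivlMl// ler_pdivrMl//; apply/andP; split.
    by rewrite lerNr -[leRHS]expRK ler_ln ?posrE ?expR_gt0.
  by rewrite lerNl -[leLHS]expRK ler_ln ?posrE ?expR_gt0.
have elogE n : 0 < q n -> elog (q n)%:E = (ln (q n))%:E by move=> q0; rewrite /elog leNgt q0.
apply/fine_cvgP; split.
  apply: filterS (main 0%N) => n [q0 _].
  by rewrite elogE.
apply/cvgrPdist_le => e e0.
apply: filterS (main (Num.Def.archi_bound e^-1)) => n [q0 le].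
suff -> : (fine \o (fun n => (n%:R^-1)%:E * - elog (q n)%:E)%E) n = n%:R^-1 * - ln (q n).
  apply: (le_trans le).
  rewrite -[leRHS]invrK lef_pV2 ?posrE ?invr_gt0//.
  rewrite (le_trans (ltW (archi_boundP _))) ?invr_ge0 ?ltW//.
  by rewrite ltr_nat.
by rewrite /= (lt_geF q0).
Qed.

Theorem mainTheorem9 (R : realType) (X : pointedType)
  (* X countably infinite *)
  (hXc : countable [set: X]) (hXi : infinite_set [set: X])
  (* mu probability on X with full support *)
  (mu : X -> R) (hmu0 : forall x, 0 < mu x)
  (hmu1 : (\esum_(x in [set: X]) (mu x)%:E)%E = 1%E)
  (* chi_l: finite partitions of X, given by surjective labelings c l *)
  (k : nat -> nat) (c : forall l, X -> 'I_(k l).+1)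
  (hcsurj : forall l (j : 'I_(k l).+1), exists x, c l x = j)
  (hc0 : k 0%N = 0%N)
  (hcref : forall l x y, c l.+1 x = c l.+1 y -> c l x = c l y)
  (hcgen : <<s [set E | exists l (j : 'I_(k l).+1), E = c l @^-1` [set j]] >>
           = [set: set X])
  (* universal measures R^l over the alphabets chi_l *)
  (Rm : forall l, probability (pathsp 'I_(k l).+1) R)
  (hRm : forall l, universal (Rm l))
  (* the stationary ergodic process *)
  (P : probability (pathsp X) R) (hPs : stationary P) (hPe : ergodic P)
  (hH : (cross_entropy1 mu P < +oo)%E) :
  {ae P, forall w : pathsp X,
     (fun n : nat =>
        (((n%:R)^-1)%:E *
         (- elog (NPD mu c Rm (blk n w))
          - (\sum_(i < n) ln (mu (w (Posz i.+1))))%:E))%E)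
     @ \oo --> entropy_rate P}.
Proof.
have imu : (\int[P]_w (- ln (mu (w (Posz 1))))%:E < +oo)%E.
  by rewrite -cross_entropy1E.
have mu1 : (\esum_(x in [set: X]) (mu x)%:E <= 1)%E by rewrite hmu1.
have H1 := block_entropy1_fin hXc hmu0 mu1 imu.
have [L [PL HL _]] := entropy_rateP hXc hPs H1.
have cellcvg x : (fun l => cellmass mu (c l) x) @ \oo --> mu x.
  apply: cellmass_cvg => // [l y|y yx]; first exact: hcref.
  exact: generating_cells_separate yx.
have excess0 := integral_excess_cvg0 hXc hmu0 hmu1 imu cellcvg.
pose q := mixprob mu c Rm.
have bounds (j : nat) : {ae P, forall w, exists m, forall n, (m <= n)%N ->
    expR (- (n%:R * (L + j.+1%:R^-1))) <= q (word n w) <= expR (- (n%:R * (L - j.+1%:R^-1)))}.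
  (* Half of the tolerance goes to the mean [excess] of a fine enough level [l], half to
     [mixprob_lower] at that level. *)
  pose e : R := j.+1%:R^-1 / 2.
  have j0 : (0 : R) < j.+1%:R^-1 by rewrite invr_gt0.
  have e0 : 0 < e by rewrite divr_gt0.
  have [l le] : exists l, fine (\int[P]_w (excess mu (c l) w)%:E)%E <= e.
    have /fine_cvgP[_ /cvgrPdist_le/(_ e e0)[l _ /(_ l (leqnn l))]] := excess0.
    by rewrite /= sub0r normrN => /(le_trans (ler_norm _)); exists l.
  have Lj : L - j.+1%:R^-1 < L by rewrite gtrBl.
  have lower := code_length_lower hXc hPs hPe hmu0 mu1 imu HL Lj
    (mixprob_ge0 hmu0 hmu1 c Rm) (mass_mixprob hmu0 hmu1 c Rm).
  have upper := @mixprob_lower _ _ hXc mu hmu0 hmu1 P hPs hPe imu k c Rm hRm L l e e0 PL H1.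
  apply: filterS2 lower upper => w [m1 h1] [m2 h2].
  exists (maxn m1 m2) => n; rewrite geq_max => /andP[n1 n2].
  rewrite h1// andbT; apply: le_trans (h2 n n2).
  rewrite ler_expR lerN2 ler_wpM2l// -addrA lerD2l.
  by rewrite [leRHS]splitr lerD2r.
(* Only countably many tolerances occur, so one null set serves for all of them. *)
apply: filterS (ae_foralln bounds) => w hw.
rewrite PL; under eq_fun do rewrite code_lengthE//.
exact: code_length_cvg.
Qed.
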